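(* Let $\mathcal{C}$ be a weakly sparse class of graphs. Then for every formula of low rank MSO there exists a formula of separator logic (with the same free variables) such that the two formulas are equivalent on all graphs from $\mathcal{C}$.
   Context: Graphs are finite, simple, undirected, and possibly vertex-colored (equipped with finitely many unary predicates). For a graph $G$ and $X\subseteq V(G)$, write $\widehat X=V(G)\setminus X$; the (cut)rank $\mathrm{rk}(X)$ is the rank over $\mathbb{F}_2$ of the $\{0,1\}$-matrix $\mathrm{Adj}_G[X,\widehat X]$ whose rows are indexed by $X$, columns by $\widehat X$, with entry $1$ iff the two vertices are adjacent. Low rank MSO is the fragment of monadic second-order logic over graphs (with quantification over vertices and over sets of vertices) built from: quantifiers $\forall x,\exists x$ over vertices; quantifiers $\forall X\colon r$, $\exists X\colon r$ (for $r\in\mathbb N$) over vertex sets $X$ with $\mathrm{rk}(X)\le r$; Boolean connectives; atomic formulas $E(x,y)$, $x=y$, $U(x)$ for unary predicates $U$, and $x\in X$. Formulas may have free vertex and set variables. Separator logic is first-order logic over graphs (allowing free set variables with membership tests $x\in X$) extended by predicates $\mathrm{conn}_k(s,t,a_1,\dots,a_k)$ for every $k\in\mathbb N$, which hold iff there is a path in $G$ with endpoints $s$ and $t$ not passing through any of $a_1,\dots,a_k$. A class $\mathcal C$ is weakly sparse if there is $t\in\mathbb N$ such that no graph in $\mathcal C$ contains the complete bipartite graph $K_{t,t}$ as a subgraph. Two formulas are equivalent on $\mathcal C$ if they are satisfied by the same evaluations of the free variables in every graph of $\mathcal C$. *)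

(* Defs.v *)
From HB Require Import structures.
From mathcomp Require Import all_boot all_order all_algebra.
Set Implicit Arguments.
Unset Strict Implicit.
Unset Printing Implicit Defensive.

(** The unary predicates (vertex colors) of a graph are indexed by a finite
    type [S]; uncolored graphs are the case of an empty [S]. *)
Record graph (S : finType) : Type := Graph {
  vertex :> finType;
  edge : rel vertex;
  edge_sym : symmetric edge;
  edge_irr : irreflexive edge;
  color : S -> {set vertex}
}.
Arguments edge {S g}.
Arguments color {S g}.

Section Graphs.
Variables (S : finType) (G : graph S).

Definition cut_matrix (X : {set G}) : 'M['F_2]_(#|X|, #|~: X|) :=
  (\matrix_(i, j) (edge (enum_val i) (enum_val j))%:R)%R.

Definition cutrank (X : {set G}) : nat := \rank (cut_matrix X).

Definition path_avoiding (s t : G) (A : seq G) : Prop :=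
  exists p : seq G, [/\ path edge s p, uniq (s :: p), last s p = t &
    {in A, forall a, a \notin s :: p}].

End Graphs.

Definition bip_edge (t : nat) : rel ('I_t + 'I_t)%type := fun u v =>
  match u, v with
  | inl _, inr _ | inr _, inl _ => true
  | _, _ => false
  end.

(** [G] contains K_{t,t} as a (not necessarily induced) subgraph. *)
Definition contains_Ktt (S : finType) (G : graph S) (t : nat) : Prop :=
  exists h : 'I_t + 'I_t -> G,
    injective h /\ forall u v, bip_edge u v -> edge (h u) (h v).

Definition weakly_sparse (S : finType) (C : graph S -> Prop) : Prop :=
  exists t : nat, forall G : graph S, C G -> ~ contains_Ktt G t.

(** Both logics use well-scoped de Bruijn indices: the free variables of a
    formula of type [lrmso S n p] or [sep S p n] are among [n] vertex variables
    and [p] set variables, and a quantifier binds the variable of index 0.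
    Free set variables carry no rank restriction; only quantified ones do. *)
Inductive lrmso (S : finType) : nat -> nat -> Type :=
| LEdge n p (x y : 'I_n) : lrmso S n p
| LEq n p (x y : 'I_n) : lrmso S n p
| LColor n p (c : S) (x : 'I_n) : lrmso S n p
| LMem n p (x : 'I_n) (X : 'I_p) : lrmso S n p
| LNot n p : lrmso S n p -> lrmso S n p
| LAnd n p : lrmso S n p -> lrmso S n p -> lrmso S n p
| LOr n p : lrmso S n p -> lrmso S n p -> lrmso S n p
| LAll n p : lrmso S n.+1 p -> lrmso S n p
| LEx n p : lrmso S n.+1 p -> lrmso S n p
| LAllSet n p (r : nat) : lrmso S n p.+1 -> lrmso S n p
| LExSet n p (r : nat) : lrmso S n p.+1 -> lrmso S n p.

Inductive sep (S : finType) (p : nat) : nat -> Type :=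
| SEdge n (x y : 'I_n) : sep S p n
| SEq n (x y : 'I_n) : sep S p n
| SColor n (c : S) (x : 'I_n) : sep S p n
| SMem n (x : 'I_n) (X : 'I_p) : sep S p n
| SConn n (k : nat) (s t : 'I_n) (a : k.-tuple 'I_n) : sep S p n
| SNot n : sep S p n -> sep S p n
| SAnd n : sep S p n -> sep S p n -> sep S p n
| SOr n : sep S p n -> sep S p n -> sep S p n
| SAll n : sep S p n.+1 -> sep S p n
| SEx n : sep S p n.+1 -> sep S p n.

Fixpoint lrmso_sat (S : finType) (G : graph S) (n p : nat) (f : lrmso S n p) :
    n.-tuple G -> p.-tuple {set G} -> Prop :=
  match f in lrmso _ n p return n.-tuple G -> p.-tuple {set G} -> Prop with
  | LEdge _ _ x y => fun v _ => edge (tnth v x) (tnth v y)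
  | LEq _ _ x y => fun v _ => tnth v x = tnth v y
  | LColor _ _ c x => fun v _ => tnth v x \in color c
  | LMem _ _ x X => fun v w => tnth v x \in tnth w X
  | LNot _ _ f => fun v w => ~ lrmso_sat f v w
  | LAnd _ _ f g => fun v w => lrmso_sat f v w /\ lrmso_sat g v w
  | LOr _ _ f g => fun v w => lrmso_sat f v w \/ lrmso_sat g v w
  | LAll _ _ f => fun v w => forall x : G, lrmso_sat f [tuple of x :: v] w
  | LEx _ _ f => fun v w => exists x : G, lrmso_sat f [tuple of x :: v] w
  | LAllSet _ _ r f => fun v w => forall X : {set G},
      cutrank X <= r -> lrmso_sat f v [tuple of X :: w]
  | LExSet _ _ r f => fun v w => exists X : {set G},
      cutrank X <= r /\ lrmso_sat f v [tuple of X :: w]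
  end.

Fixpoint sep_sat (S : finType) (G : graph S) (p : nat) (w : p.-tuple {set G})
    (n : nat) (f : sep S p n) : n.-tuple G -> Prop :=
  match f in sep _ _ n return n.-tuple G -> Prop with
  | SEdge _ x y => fun v => edge (tnth v x) (tnth v y)
  | SEq _ x y => fun v => tnth v x = tnth v y
  | SColor _ c x => fun v => tnth v x \in color c
  | SMem _ x X => fun v => tnth v x \in tnth w X
  | SConn _ _ s t a => fun v =>
      path_avoiding (tnth v s) (tnth v t) [seq tnth v i | i <- a]
  | SNot _ f => fun v => ~ sep_sat w f v
  | SAnd _ f g => fun v => sep_sat w f v /\ sep_sat w g v
  | SOr _ f g => fun v => sep_sat w f v \/ sep_sat w g v
  | SAll _ f => fun v => forall x : G, sep_sat w f [tuple of x :: v]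
  | SEx _ f => fun v => exists x : G, sep_sat w f [tuple of x :: v]
  end.

Definition equivalent_on (S : finType) (C : graph S -> Prop) (n p : nat)
    (f : lrmso S n p) (g : sep S p n) : Prop :=
  forall G : graph S, C G -> forall (v : n.-tuple G) (w : p.-tuple {set G}),
    lrmso_sat f v w <-> sep_sat w g v.

(* Main.v *)
(** In a K_{t,t}-free graph the edges of a cut of rank at most r are covered by
    a set [a] of bounded size: the rows and the columns of the cut matrix fall
    into at most 2^r classes, adjacent classes are completely adjacent, so one
    of the two has fewer than t elements. Hence a set X of cut rank at most r
    is, outside [a], a union of connected components of G - a.

    Whether (G, X) satisfies a formula of separator logic of quantifier depth q
    depends only on the numbers, capped at q + 1, of components of G - a of
    each local type of depth q inside and outside X (an
    Ehrenfeucht-Fraisse argument; a path splits at [a] into segments lying in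
    single components). Local types are definable in separator logic, so X may
    be replaced by a set that is definable from [a] and boundedly many further
    vertices: for every type, take few components, or all but few of them. *)

Require Import Defs.
From mathcomp Require Import all_boot all_order all_algebra zify.
From Stdlib Require Import Classical.
Set Implicit Arguments.
Unset Strict Implicit.
Unset Printing Implicit Defensive.

(** * Definability in separator logic *)

Section Definable.
Variable S : finType.

Definition definable p n
    (P : forall G : graph S, p.-tuple {set G} -> n.-tuple G -> Prop) :=
  exists psi : sep S p n, forall G w v, P G w v <-> sep_sat w psi v.

Section Closure.
Variable p : nat.
Local Notation gpred n :=
  (forall G : graph S, p.-tuple {set G} -> n.-tuple G -> Prop).

Lemma definable_iff n (P Q : gpred n) :
  (forall G w v, P G w v <-> Q G w v) -> definable P -> definable Q.
Proof. by move=> h [f hf]; exists f => G w v; rewrite -h. Qed.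

Lemma definable_sat n (f : sep S p n) :
  definable (fun G w v => sep_sat w f v).
Proof. by exists f. Qed.

Lemma definable_not n (P : gpred n) :
  definable P -> definable (fun G w v => ~ P G w v).
Proof. by case=> f hf; exists (SNot f) => G w v /=; rewrite hf. Qed.

Lemma definable_and n (P Q : gpred n) :
  definable P -> definable Q -> definable (fun G w v => P G w v /\ Q G w v).
Proof.
by case=> f hf [g hg]; exists (SAnd f g) => G w v /=; rewrite hf hg.
Qed.

Lemma definable_or n (P Q : gpred n) :
  definable P -> definable Q -> definable (fun G w v => P G w v \/ Q G w v).
Proof.
by case=> f hf [g hg]; exists (SOr f g) => G w v /=; rewrite hf hg.
Qed.

Lemma definable_ex n (P : gpred n.+1) :
  definable P -> definable (fun G w v => exists x : G, P G w [tuple of x :: v]).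
Proof.
by case=> f hf; exists (SEx f) => G w v /=; split=> -[x hx]; exists x; apply/hf.
Qed.

Lemma definable_all n (P : gpred n.+1) :
  definable P -> definable (fun G w v => forall x : G, P G w [tuple of x :: v]).
Proof.
by case=> f hf; exists (SAll f) => G w v /=; split=> h x; apply/hf.
Qed.

Lemma definable_true n : definable (fun (G : graph S) (w : p.-tuple {set G})
  (v : n.-tuple G) => True).
Proof.
case: n => [|n].
  exists (SAll (SEq S p ord0 ord0)) => G w v; split=> // _ x; exact: erefl.
by exists (SEq S p ord0 ord0).
Qed.

Lemma definable_const n (Q : Prop) : definable (fun (G : graph S)
  (w : p.-tuple {set G}) (v : n.-tuple G) => Q).
Proof.
have ht := definable_true n.
have [hQ|hQ] := classic Q; first by apply: definable_iff ht.
by apply: definable_iff (definable_not ht) => G w v; tauto.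
Qed.

Lemma definable_imp n (P Q : gpred n) :
  definable P -> definable Q -> definable (fun G w v => P G w v -> Q G w v).
Proof.
move=> hP hQ; apply: definable_iff (definable_or (definable_not hP) hQ).
move=> G w v; split; first tauto.
by have [|] := classic (P G w v); tauto.
Qed.

Lemma definable_equiv n (P Q : gpred n) :
  definable P -> definable Q -> definable (fun G w v => P G w v <-> Q G w v).
Proof.
by move=> hP hQ; apply: definable_and; apply: definable_imp.
Qed.

Lemma definable_ex_fin n (T : finType) (P : T -> gpred n) :
  (forall i, definable (P i)) ->
  definable (fun G w v => exists i, P i G w v).
Proof.
move=> hP.
suff: forall s : seq T, definable (fun G w v => exists2 i, i \in s & P i G w v).
  move/(_ (enum T)); apply: definable_iff => G w v.
  by split=> [[i _ hi]|[i hi]]; exists i; rewrite ?mem_enum.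
elim=> [|x s IH].
  by apply: definable_iff (definable_const n False) => G w v; split=> // -[].
apply: definable_iff (definable_or (hP x) IH) => G w v; split.
  by case=> [hx|[i hi]]; [exists x | exists i]; rewrite // inE ?eqxx ?hi ?orbT.
by case=> i; rewrite inE => /orP[/eqP-> | hi]; [left | right; exists i].
Qed.

Lemma definable_all_fin n (T : finType) (P : T -> gpred n) :
  (forall i, definable (P i)) ->
  definable (fun G w v => forall i, P i G w v).
Proof.
move=> hP.
have := definable_not (definable_ex_fin (fun i => definable_not (hP i))).
apply: definable_iff => G w v; split=> [h i|h [i hi]]; last exact: hi.
by apply: NNPP => hi; apply: h; exists i.
Qed.

Lemma definable_set_eq n (T : finType)
    (P : T -> forall G : graph S, p.-tuple {set G} -> n.-tuple G -> bool) :
  (forall i, definable (P i)) ->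
  forall s, definable (fun G w v => [set i | P i G w v] = s).
Proof.
move=> hP s.
have := definable_all_fin
  (fun i => definable_equiv (hP i) (definable_const n (i \in s))).
apply: definable_iff => G w v; split=> [h|<- i]; last by rewrite inE.
by apply/setP=> i; rewrite inE; apply/idP/idP; apply h.
Qed.

Lemma definable_ex_tuple k n (P : gpred (k + n)) :
  definable P ->
  definable (fun G w v => exists u : k.-tuple G, P G w [tuple of u ++ v]).
Proof.
elim: k P => [|k IH] P hP.
  apply: definable_iff hP => G w v; split=> [h|[u]].
    by exists [tuple]; congr (P _ _ _): h; apply: val_inj.
  by rewrite (tuple0 u); congr (P _ _ _); apply: val_inj.
apply: definable_iff (IH _ (definable_ex (n := k + n) hP)) => G w v; split.
  move=> [u [x h]]; exists [tuple of x :: u].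
  by congr (P _ _ _): h; apply: val_inj.
case=> u; case/tupleP: u => x u h; exists u, x.
by congr (P _ _ _): h; apply: val_inj.
Qed.

Definition lift_ren k n (r : 'I_k -> 'I_n) (i : 'I_k.+1) : 'I_n.+1 :=
  if unlift ord0 i is Some j then lift ord0 (r j) else ord0.

Definition proj (T : Type) k n (r : 'I_k -> 'I_n) (v : n.-tuple T) : k.-tuple T :=
  [tuple tnth v (r i) | i < k].

Lemma proj_cons (T : Type) k n (r : 'I_k -> 'I_n) (x : T) (v : n.-tuple T) :
  [tuple of x :: proj r v] = proj (lift_ren r) [tuple of x :: v].
Proof.
apply: eq_from_tnth => i; rewrite tnth_mktuple /lift_ren.
by case: unliftP => [j|] ->; rewrite ?tnth0 // !tnthS tnth_mktuple.
Qed.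

Lemma proj_lift (T : Type) k n (r : 'I_k -> 'I_n) (x : T) (v : n.-tuple T) :
  proj (fun i => lift ord0 (r i)) [tuple of x :: v] = proj r v.
Proof. by apply: eq_from_tnth => i; rewrite !tnth_mktuple tnthS. Qed.

Lemma definable_edge n (x y : 'I_n) :
  definable (fun G (w : p.-tuple {set G}) v => edge (tnth v x) (tnth v y)).
Proof. by exists (SEdge _ _ x y). Qed.

Lemma definable_eq n (x y : 'I_n) :
  definable (fun G (w : p.-tuple {set G}) v => tnth v x = tnth v y).
Proof. by exists (SEq _ _ x y). Qed.

Lemma definable_color n c (x : 'I_n) :
  definable (fun G (w : p.-tuple {set G}) v => tnth v x \in color c).
Proof. by exists (SColor _ c x). Qed.

Lemma definable_mem n (x : 'I_n) X :
  definable (fun G (w : p.-tuple {set G}) v => tnth v x \in tnth w X).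
Proof. by exists (SMem _ x X). Qed.

Lemma definable_path n (s t : 'I_n) k (a : k.-tuple 'I_n) :
  definable (fun G (w : p.-tuple {set G}) v =>
    path_avoiding (tnth v s) (tnth v t) [seq tnth v i | i <- a]).
Proof. by exists (SConn _ _ s t a). Qed.

Lemma definable_ren k n (r : 'I_k -> 'I_n) (P : gpred k) :
  definable P -> definable (fun G w v => P G w (proj r v)).
Proof.
case=> f hf.
suff: definable (fun G w v => sep_sat w f (proj r v)).
  by apply: definable_iff => G w v; rewrite hf.
elim: {P hf} k / f n r => /=.
- move=> k x y n r; apply: definable_iff (definable_edge (r x) (r y)).
  by move=> G w v; rewrite !tnth_mktuple.
- move=> k x y n r; apply: definable_iff (definable_eq (r x) (r y)).
  by move=> G w v; rewrite !tnth_mktuple.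
- move=> k c x n r; apply: definable_iff (definable_color c (r x)).
  by move=> G w v; rewrite !tnth_mktuple.
- move=> k x X n r; apply: definable_iff (definable_mem (r x) X).
  by move=> G w v; rewrite !tnth_mktuple.
- move=> k l s t a n r.
  apply: definable_iff (definable_path (r s) (r t) (map_tuple r a)).
  move=> G w v; rewrite !tnth_mktuple /= -map_comp.
  by rewrite (eq_map (_ : _ =1 tnth (proj r v))) // => i; rewrite tnth_mktuple.
- by move=> k f IH n r; apply: definable_not.
- by move=> k f IHf g IHg n r; apply: definable_and.
- by move=> k f IHf g IHg n r; apply: definable_or.
- move=> k f IH n r; apply: definable_iff (definable_all (IH _ (lift_ren r))).
  by move=> G w v; split=> h x; move: (h x); rewrite proj_cons.
- move=> k f IH n r; apply: definable_iff (definable_ex (IH _ (lift_ren r))).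
  by move=> G w v; split=> -[x h]; exists x; move: h; rewrite proj_cons.
Qed.

End Closure.

Lemma behead_cons (T : Type) n (x : T) (v : n.-tuple T) :
  behead_tuple [tuple of x :: v] = v.
Proof. exact: val_inj. Qed.

Lemma proj_skip (T : Type) n (v : n.+2.-tuple T) :
  thead (proj (lift_ren (lift ord0)) v) = thead v /\
  behead_tuple (proj (lift_ren (lift ord0)) v) = behead_tuple (behead_tuple v).
Proof.
case/tupleP: v => x v; case/tupleP: v => y v.
rewrite -proj_cons !theadE !behead_cons; split=> //.
by rewrite (proj_lift (fun i => i)); apply: eq_from_tnth => i; rewrite tnth_mktuple.
Qed.

Lemma definable_subst p n (f : sep S p.+1 n)
    (D : forall G : graph S, p.-tuple {set G} -> n.-tuple G -> {set G}) :
  definable (fun G w (v : n.+1.-tuple G) => thead v \in D G w (behead_tuple v)) ->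
  definable (fun G w v => sep_sat [tuple of D G w v :: w] f v).
Proof.
elim: n / f D => /=.
- by move=> k x y D hD; exact: definable_edge.
- by move=> k x y D hD; exact: definable_eq.
- by move=> k c x D hD; exact: definable_color.
- move=> k x X D hD; case: (unliftP ord0 X) => [Y|] -> {X}.
    by apply: definable_iff (definable_mem x Y) => G w v; rewrite tnthS.
  have := definable_and (definable_eq p ord0 (lift ord0 x)) hD.
  move/definable_ex; apply: definable_iff => G w v.
  rewrite tnth0; split=> [[y [/= hy]]|h].
    by rewrite tnth0 tnthS in hy; rewrite theadE behead_cons hy.
  by exists (tnth v x); rewrite tnth0 tnthS theadE behead_cons.
- by move=> k l s t a D hD; exact: definable_path.
- by move=> k f IH D hD; apply/definable_not/IH.
- by move=> k f IHf g IHg D hD; apply: definable_and; [apply: IHf|apply: IHg].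
- by move=> k f IHf g IHg D hD; apply: definable_or; [apply: IHf|apply: IHg].
- move=> k f IH D hD.
  have := definable_all (IH (fun G w v => D G w (behead_tuple v)) _).
  have hD' := definable_ren (lift_ren (lift ord0)) hD.
  move=> /(_ (definable_iff _ hD')) h; apply: definable_iff (h _) => {h} G w v.
    by split=> h x; move: (h x); rewrite behead_cons.
  by rewrite (proj_skip v).1 (proj_skip v).2.
- move=> k f IH D hD.
  have := definable_ex (IH (fun G w v => D G w (behead_tuple v)) _).
  have hD' := definable_ren (lift_ren (lift ord0)) hD.
  move=> /(_ (definable_iff _ hD')) h; apply: definable_iff (h _) => {h} G w v.
    by split=> -[x h]; exists x; move: h; rewrite behead_cons.
  by rewrite (proj_skip v).1 (proj_skip v).2.
Qed.
End Definable.

(** * Capped counting *)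

Section CappedCounts.
Variable T : eqType.
Implicit Types s : seq T.

Definition capped_eq (M : nat) s1 s2 :=
  forall x, minn M (count_mem x s1) = minn M (count_mem x s2).

Lemma capped_eq_sym M s1 s2 : capped_eq M s1 s2 -> capped_eq M s2 s1.
Proof. by move=> h x. Qed.

Lemma capped_eq_weak M s1 s2 : capped_eq M.+1 s1 s2 -> capped_eq M s1 s2.
Proof.
by move=> h y; move: (h y); set c1 := count _ _; set c2 := count _ _; lia.
Qed.

Lemma capped_eq_mem M s1 s2 : capped_eq M.+1 s1 s2 -> s1 =i s2.
Proof.
move=> h x; rewrite -!has_pred1 !has_count.
by move: (h x); set c1 := count _ _; set c2 := count _ _; lia.
Qed.

Lemma capped_eq_cons M x s1 s2 :
  capped_eq M s1 s2 -> capped_eq M (x :: s1) (x :: s2).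
Proof.
by move=> h y /=; move: (h y); set c1 := count _ _; set c2 := count _ _; lia.
Qed.

Lemma capped_eq_behead M x s1 s2 :
  capped_eq M.+1 (x :: s1) (x :: s2) -> capped_eq M s1 s2.
Proof.
move=> h y; move: (h y) => /=; set c1 := count _ _; set c2 := count _ _.
by case: (x == y) => /=; lia.
Qed.

Lemma capped_eq_perm M s1 s2 s1' s2' : perm_eq s1 s1' -> perm_eq s2 s2' ->
  capped_eq M s1 s2 -> capped_eq M s1' s2'.
Proof. by move=> /permP h1 /permP h2 h x; rewrite -h1 -h2. Qed.

End CappedCounts.

Lemma count_sum (T : finType) (P : pred T) (s : seq T) :
  count P s = \sum_(x | P x) count_mem x s.
Proof.
elim: s => [|y s IH] /=; first by rewrite big1.
rewrite big_split /= -IH; congr (_ + _).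
case: (boolP (P y)) => hy.
  rewrite (bigD1 y) //= eqxx big1 ?addn0 // => x /andP[_ hx].
  by rewrite eq_sym (negPf hx).
by rewrite big1 // => x hx; case: eqP => // e; rewrite e hx in hy.
Qed.

Lemma capped_eq_map (T : finType) (T' : eqType) (f : T -> T') M s1 s2 :
  capped_eq M s1 s2 -> capped_eq M (map f s1) (map f s2).
Proof.
move=> h y; rewrite !count_map !count_sum.
apply: (big_ind2 (fun a b => minn M a = minn M b)) => [//|a b c d|i _ //].
lia.
Qed.

Lemma capped_choice_class (T : finType) M (F : {set T}) (b : pred T) :
  exists (E : {set T}) (d : bool), [/\ E \subset F, #|E| <= M &
    forall c, minn M #|[set k in F | b k == c]| =
              minn M #|[set k in F | (d (+) (k \in E)) == c]|].
Proof.
pose I c := [set k in F | b k == c].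
have sI c : I c \subset F by apply/subsetP => k; rewrite inE => /andP[].
have hI c k : k \in F -> (k \in I c) = (b k == c) by rewrite inE => ->.
have [h|h] := leqP #|I true| M.
  exists (I true), false; split=> // c; congr minn; apply: eq_card => k.
  rewrite !inE; case hk: (k \in F) => //=.
  by case: (b k).
have [h'|h'] := leqP #|I false| M.
  exists (I false), true; split=> // c; congr minn; apply: eq_card => k.
  rewrite !inE; case hk: (k \in F) => //=.
  by case: (b k).
pose E := [set k in take M (enum (I true))].
have sE : E \subset I true.
  by apply/subsetP => k; rewrite inE => /mem_take; rewrite mem_enum.
have cE : #|E| = M.
  have /card_uniqP hu : uniq (take M (enum (I true))) by rewrite take_uniq ?enum_uniq.
  rewrite cardsE hu.
  by rewrite size_take -cardE h.
exists E, false; split; [exact: subset_trans sE _ | by rewrite cE | case].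
  have -> : [set k in F | (false (+) (k \in E)) == true] = E.
    apply/setP=> k; rewrite [LHS]inE eqb_id /=; apply/andP/idP => [[]//|hk].
    by split=> //; apply: (subsetP (sI true)); apply: (subsetP sE).
  by rewrite -/(I true) cE; lia.
have sub : I false \subset [set k in F | (false (+) (k \in E)) == false].
  apply/subsetP => k; rewrite [_ \in I _]inE => /andP[hk /eqP hb].
  rewrite inE hk; apply/eqP/negP => /(subsetP sE).
  by rewrite inE hb andbF.
by have := subset_leq_card sub; rewrite -/(I false); lia.
Qed.

Lemma count_tag (K T : finType) (C : {set K}) (f : K -> T) (b : K -> bool) t c :
  count_mem (t, c) [seq (f k, b k) | k <- enum C] =
  #|[set k in [set k in C | f k == t] | b k == c]|.
Proof.
rewrite count_map -size_filter; set p := (X in filter X).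
have /card_uniqP <- : uniq (filter p (enum C)) by rewrite filter_uniq ?enum_uniq.
apply: eq_card => k; rewrite !inE mem_filter mem_enum /p /=.
by rewrite andbC -[X in _ && X]/((f k == t) && (b k == c)) andbA.
Qed.

Lemma capped_choice (K T : finType) M (C : {set K}) (f : K -> T) (b : pred K) :
  exists (E : {set K}) (full : {set T}), [/\ E \subset C, #|E| <= M * #|T| &
    capped_eq M [seq (f k, b k) | k <- enum C]
                [seq (f k, (f k \in full) (+) (k \in E)) | k <- enum C]].
Proof.
pose F t := [set k in C | f k == t].
have /fin_all_exists[E /fin_all_exists[d h]] :=
  fun t => capped_choice_class M (F t) b.
pose U := \bigcup_t E t.
have sE t k : k \in E t -> k \in C /\ f k = t.
  by have [/subsetP sEF _ _] := h t; move/sEF; rewrite inE => /andP[-> /eqP].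
have EU k : (k \in U) = (k \in E (f k)).
  apply/bigcupP/idP => [[t _ hk]|]; last by exists (f k).
  by rewrite (sE _ _ hk).2.
exists U, [set t | d t]; split.
- by apply/bigcupsP => t _; apply/subsetP => k /sE[].
- apply: leq_trans (_ : \sum_(t : T) #|E t| <= _).
    rewrite /U; elim/big_ind2: _ => [|A a B c hA hB|//]; first by rewrite cards0.
    by apply: leq_trans (leq_card_setU _ _) _; apply: leq_add.
  rewrite mulnC -sum_nat_const; apply: leq_sum => t _; by case: (h t).
case=> t c; rewrite !count_tag; have [_ _ ->] := h t.
congr minn; apply: eq_card => k; rewrite !inE EU.
by case: eqP => [<-|]; rewrite ?andbF.
Qed.

(** * Separation and components *)

Section Separation.
Variables (S : finType) (G : graph S).
Implicit Types (A B K : {set G}) (x y z u : G).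

Definition avoid B : rel G := [rel x y | [&& edge x y, x \notin B & y \notin B]].

Definition sconn B x y := (x \notin B) && connect (avoid B) x y.

Lemma avoidE B x y :
  avoid B x y = [&& edge x y, x \notin B & y \notin B].
Proof. by []. Qed.

Lemma avoid_sym B : connect_sym (avoid B).
Proof.
apply: sym_connect_sym => x y; rewrite !avoidE edge_sym.
by congr (_ && _); rewrite andbC.
Qed.

Lemma sconnr B x y : sconn B x y -> y \notin B.
Proof.
case/andP=> hx /connectP[p hp ->]; elim: p x hx hp => //= z p IH x hx.
by case/andP=> /and3P[_ _ hz]; apply: IH.
Qed.

Lemma sconn_sym B x y : sconn B x y = sconn B y x.
Proof.
by apply/idP/idP => h; rewrite /sconn (sconnr h) avoid_sym; case/andP: h.
Qed.

Lemma sconn_refl B x : x \notin B -> sconn B x x.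
Proof. by move=> hx; rewrite /sconn hx connect0. Qed.

Lemma sconn_trans B y x z : sconn B x y -> sconn B y z -> sconn B x z.
Proof.
case/andP=> hx h /andP[_ h']; rewrite /sconn hx; exact: connect_trans h h'.
Qed.

Lemma sconn_edge B x y : x \notin B -> y \notin B -> edge x y -> sconn B x y.
Proof. by move=> hx hy e; rewrite /sconn hx connect1 // avoidE e hx. Qed.

Lemma sconn_sub A B x y : B \subset A -> sconn A x y -> sconn B x y.
Proof.
move=> sBA /andP[hx h].
have sub z : z \notin A -> z \notin B by apply: contra => /(subsetP sBA).
rewrite /sconn sub //; apply: connect_sub h => u v /and3P[e hu hv].
by apply: connect1; rewrite avoidE e !sub.
Qed.

Lemma path_avoidingP x y (s : seq G) :
  path_avoiding x y s <-> sconn [set z in s] x y.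
Proof.
split.
  case=> p [hp _ <- hs].
  have hs' z : z \in x :: p -> z \notin [set z in s].
    by rewrite inE => hz; apply/negP => /hs; rewrite hz.
  apply/andP; split; first by rewrite hs' ?mem_head.
  apply/connectP; exists p => //.
  elim: p x hp {hs} hs' => //= z p IH x /andP[e hp] hs'.
  rewrite avoidE e !hs' ?inE ?eqxx ?orbT //=; apply: IH => // u hu.
  by apply: hs'; rewrite inE hu orbT.
case/andP=> hx /connectP[p hp ->]; case/shortenP: hp => p' hp' up' _.
exists p'; split=> //.
  by apply: sub_path hp' => u v /and3P[].
move=> z hz; rewrite inE negb_or; apply/andP; split.
  by apply: contraNneq hx => <-; rewrite inE.
apply/negP => hzp; have : z \in [set u in s] by rewrite inE.
apply/negP; elim: p' x hp' hzp {up' hx} => //= u p' IH x /andP[/and3P[_ _ hu] hp].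
by rewrite in_cons => /orP[/eqP-> //|]; exact: IH hp.
Qed.

Section Components.
Variable A : {set G}.

Definition component x := [set y | sconn A x y].

(* The empty set is included so that the vertices of [A] are seen even when
   nothing else is left. *)
Definition components : seq {set G} := set0 :: enum [set component y | y in ~: A].

Lemma mem_component y : y \notin A -> y \in component y.
Proof. by rewrite inE; exact: sconn_refl. Qed.

Lemma component_components y : y \notin A -> component y \in components.
Proof.
by move=> hy; rewrite inE mem_enum; apply/orP; right; apply: imset_f; rewrite inE.
Qed.

Lemma components_notin K x : K \in components -> x \in K -> x \notin A.
Proof.
rewrite inE mem_enum => /orP[/eqP-> | /imsetP[y _ ->]]; rewrite inE //.
exact: sconnr.
Qed.

Lemma components_component K x : K \in components -> x \in K -> K = component x.
Proof.
rewrite inE mem_enum => /orP[/eqP-> | /imsetP[y _ ->]]; rewrite inE // => h.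
apply/setP=> z; rewrite !inE; apply/idP/idP; last exact: sconn_trans.
by apply: sconn_trans; rewrite sconn_sym.
Qed.

Lemma components_conn K x y : K \in components -> x \in K -> (y \in K) = sconn A x y.
Proof. by move=> hK hx; rewrite (components_component hK hx) inE. Qed.

Lemma uniq_components : uniq components.
Proof.
rewrite /= enum_uniq andbT mem_enum; apply/imsetP => -[y].
rewrite inE => hy e; have := mem_component hy; by rewrite -e inE.
Qed.

Definition seg K B x y := [&& x \in K :|: A, y \in K :|: A, x \notin B, y \notin B &
  [|| x == y, edge x y |
   [exists u, exists u', [&& u \in K, u' \in K, (x == u) || edge x u,
      (u' == y) || edge u' y & sconn (A :|: B) u u']]]].

Lemma seg_conn K B x y : seg K B x y -> sconn B x y.
Proof.
case/and5P=> _ _ hx hy /or3P[/eqP-> | | ].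
- exact: sconn_refl.
- exact: sconn_edge.
case/existsP=> u /existsP[u' /and5P[_ _ xu uy h]].
have h' : sconn B u u' by apply: sconn_sub h; apply: subsetUr.
have hu : u \notin B by case/andP: h'.
have hu' := sconnr h'.
apply: (@sconn_trans _ u); last apply: (sconn_trans h').
- by case/orP: xu => [/eqP-> | e]; [apply: sconn_refl | apply: sconn_edge].
- by case/orP: uy => [/eqP-> | e]; [apply: sconn_refl | apply: sconn_edge].
Qed.

Definition seg_rel (P : Type) (f : P -> G) B : rel P :=
  fun x y : P => has (fun K => seg K B (f x) (f y)) components.

(* A path avoiding [B] splits at the vertices of [A] into segments, each of
   which stays inside one component of [G - A]. *)
Lemma conn_segs (P : finType) (f : P -> G) B (i j : P) :
  (forall x, x \in A -> exists l, f l = x) ->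
  sconn B (f i) (f j) = seg_rel f B i i && connect (seg_rel f B) i j.
Proof.
move=> hA; set R := seg_rel f B.
have RE (x y : P) : R x y = has (fun K => seg K B (f x) (f y)) components by [].
have visible x : exists2 K, K \in components & x \in K :|: A.
  have [hx|hx] := boolP (x \in A).
    by exists set0; rewrite ?inE ?eqxx ?hx ?orbT.
  by exists (component x); rewrite ?component_components // inE mem_component.
have Rrefl (x : P) : f x \notin B -> R x x.
  move=> hx; have [K hK hxK] := visible (f x).
  by rewrite RE; apply/hasP; exists K => //; rewrite /seg hxK hx eqxx.
apply/idP/andP; last first.
  case=> Rii /connectP[p hp ->].
  have hi : f i \notin B by move: Rii; rewrite RE => /hasP[K _ /and5P[]].
  elim: p i hp hi {Rii} => [|k p IH] i /=; first by move=> _; apply: sconn_refl.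
  case/andP; rewrite RE => /hasP[K _ /seg_conn h] hp _.
  exact: sconn_trans h (IH _ hp (sconnr h)).
case/andP=> hi /connectP[p hp ej]; split; first exact: Rrefl.
pose half (y : P) u := exists K (w : G), [/\ K \in components, f y \in K :|: A, w \in K,
  (f y == w) || edge (f y) w & sconn (A :|: B) w u].
pose reach u := exists y : P, [/\ connect R i y, f y \notin B & f y = u \/ half y u].
have half_in K w u : K \in components -> w \in K -> sconn (A :|: B) w u -> u \in K.
  move=> hK hw h; rewrite (components_conn _ hK hw).
  by apply: sconn_sub h; apply: subsetUl.
have close u (z : P) : f z = u -> u \notin B -> reach u -> connect R i z.
  move=> ez hu [y [iy hy h]]; apply: connect_trans iy _; apply: connect1.
  case: h => [e|[K [w [hK hyK hw yw wu]]]].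
    have [K hK hxK] := visible u.
    by rewrite RE; apply/hasP; exists K => //; rewrite /seg ez e hxK hu eqxx.
  have huK := half_in _ _ _ hK hw wu.
  rewrite RE; apply/hasP; exists K => //; rewrite /seg ez hyK hy hu inE huK /=.
  apply/or3P/Or33; apply/existsP; exists w; apply/existsP; exists u.
  by rewrite hw huK yw eqxx.
have step u u' : u \notin B -> u' \notin B -> edge u u' -> reach u -> reach u'.
  move=> hu hu' e ru.
  have direct (y : P) K : connect R i y -> f y = u -> K \in components -> u \in K :|: A ->
      u' \in K :|: A -> reach u'.
    move=> iy fy hK huK hu'K; have [hA'|hA'] := boolP (u' \in A).
      have [l hl] := hA _ hA'; exists l; rewrite hl; split=> //; last by left.
      apply: connect_trans iy (connect1 _); rewrite RE; apply/hasP; exists K => //.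
      by rewrite /seg fy hl huK hu'K hu hu' e orbT.
    exists y; rewrite fy; split=> //; right; exists K, u'.
    split; rewrite ?fy ?e ?orbT //; first by move: hu'K; rewrite inE (negPf hA') orbF.
    by apply: sconn_refl; rewrite inE negb_or hA'.
  have [hAu|hAu] := boolP (u \in A).
    have [l hl] := hA _ hAu; have [K hK hu'K] := visible u'.
    by apply: (direct l K) => //; [exact: close ru | rewrite inE hAu orbT].
  have [hA'|hA'] := boolP (u' \in A); last first.
    have u'u : sconn A u u' by apply: sconn_edge.
    case: ru => y [iy hy [fy|[K [w [hK hyK hw yw wu]]]]].
      by apply: (direct y (component u)) => //; rewrite ?component_components // inE;
        [rewrite mem_component | rewrite inE u'u].
    exists y; split=> //; right; exists K, w; split=> //.
    by apply: (sconn_trans wu); apply: sconn_edge; rewrite // inE negb_or ?hAu ?hA'.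
  case: ru => y [iy hy [fy|[K [w [hK hyK hw yw wu]]]]].
    by apply: (direct y (component u)) => //; rewrite ?component_components // inE ?hA' ?orbT //
      mem_component.
  have huK := half_in _ _ _ hK hw wu.
  have [l hl] := hA _ hA'; exists l; rewrite hl; split=> //; last by left.
  apply: connect_trans iy (connect1 _); rewrite RE; apply/hasP; exists K => //.
  rewrite /seg hyK hl inE hA' orbT hy hu' /=; apply/or3P/Or33.
  by apply/existsP; exists w; apply/existsP; exists u; rewrite hw huK yw e orbT.
have ri : reach (f i) by exists i; split=> //; left.
have hj : f j \notin B by apply: (@sconnr _ (f i)); rewrite /sconn hi ej; apply/connectP; exists p.
apply: (close (f j)) => //; rewrite ej.
elim: p {ej hj} (f i) hp ri => [|u p IH] x //= /andP[/and3P[e hx hu] hp] rx.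
exact: IH hp (step _ _ hx hu e rx).
Qed.

End Components.
End Separation.

Section Mask.
Variables (S : finType) (G : graph S) (A : {set G}).

Lemma sconn_mask K (B B' : {set G}) u u' : K \in components A -> u \in K ->
  {in K, B =i B'} -> sconn (A :|: B) u u' -> sconn (A :|: B') u u'.
Proof.
move=> hK hu hB /andP[hu1 /connectP[s hs ->]].
elim: s u hu hu1 hs => [|z s IH] u hu hu1 /=.
  by move=> _; apply: sconn_refl; move: hu1; rewrite !inE hB.
case/andP=> /and3P[e _ hz] hs.
have [hzA hzB] : z \notin A /\ z \notin B by move: hz; rewrite inE negb_or => /andP.
have hzK : z \in K.
  rewrite (components_conn _ hK hu); apply: sconn_edge => //; exact: components_notin hK hu.
apply: (@sconn_trans _ _ _ z); last exact: IH.
apply: sconn_edge => //; first by move: hu1; rewrite !inE hB.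
by rewrite inE negb_or hzA -hB.
Qed.

Lemma seg_mask K (B B' : {set G}) x y : K \in components A ->
  {in K :|: A, B =i B'} -> seg A K B x y = seg A K B' x y.
Proof.
move=> hK.
suff mask_imp (D D' : {set G}) : {in K :|: A, D =i D'} -> seg A K D x y -> seg A K D' x y.
  move=> hB; apply/idP/idP; apply: mask_imp => //.
  by move=> z hz; rewrite hB.
move=> hD /and5P[hx hy hxD hyD h]; rewrite /seg hx hy -!hD // hxD hyD.
case/or3P: h => [-> // | -> | /existsP[u /existsP[u' /and5P[hu hu' xu uy h]]]].
  by rewrite orbT.
apply/or3P/Or33/existsP; exists u; apply/existsP; exists u'; apply/and5P; split=> //.
by apply: (sconn_mask hK hu) h => z hz; apply: hD; rewrite inE hz.
Qed.

End Mask.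

(** * Local types of components *)

Section LocalTypes.
Variables (S : finType) (p m : nat).

Definition point n : finType := ('I_m + 'I_n)%type.

Definition atom_idx n : finType :=
  ('I_n + point n * point n + 'I_n * 'I_n + 'I_n * S + 'I_n * 'I_p +
   point n * point n * {set 'I_n})%type.

Definition atom_in n (i : 'I_n) : atom_idx n := inl (inl (inl (inl (inl i)))).
Definition atom_eq n (x y : point n) : atom_idx n :=
  inl (inl (inl (inl (inr (x, y))))).
Definition atom_edge n (i j : 'I_n) : atom_idx n := inl (inl (inl (inr (i, j)))).
Definition atom_color n (i : 'I_n) (c : S) : atom_idx n := inl (inl (inr (i, c))).
Definition atom_mem n (i : 'I_n) (j : 'I_p) : atom_idx n := inl (inr (i, j)).
Definition atom_seg n (x y : point n) (B : {set 'I_n}) : atom_idx n :=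
  inr (x, y, B).

Fixpoint tp (q n : nat) : finType :=
  if q is q'.+1 then ({set atom_idx n} * {set tp q' n.+1})%type
  else {set atom_idx n}.

Definition tp_atoms q n : tp q n -> {set atom_idx n} :=
  match q with 0 => id | _.+1 => fst end.

Variables (G : graph S) (w : p.-tuple {set G}) (a : m.-tuple G).

Definition pt n (v : n.-tuple G) (x : point n) : G :=
  match x with inl l => tnth a l | inr i => tnth v i end.

Let A : {set G} := [set x in a].
Implicit Types K X : {set G}.

(* Atoms only see the part of [v] that lies in [K :|: A]. *)
Definition atom K n (v : n.-tuple G) (i : atom_idx n) : bool :=
  match i with
  | inl (inl (inl (inl (inl i)))) => tnth v i \in K
  | inl (inl (inl (inl (inr (x, y))))) => (pt v x \in K :|: A) && (pt v x == pt v y)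
  | inl (inl (inl (inr (i, j)))) =>
      [&& tnth v i \in K :|: A, tnth v j \in K :|: A & edge (tnth v i) (tnth v j)]
  | inl (inl (inr (i, c))) => (tnth v i \in K :|: A) && (tnth v i \in color c)
  | inl (inr (i, j)) => (tnth v i \in K :|: A) && (tnth v i \in tnth w j)
  | inr (x, y, B) => seg A K [set tnth v i | i in B] (pt v x) (pt v y)
  end.

Definition atoms K n (v : n.-tuple G) := [set i | atom K v i].

Lemma in_atoms K n (v : n.-tuple G) i : (i \in atoms K v) = atom K v i.
Proof. exact: in_set. Qed.

Fixpoint ltp q K n (v : n.-tuple G) : tp q n :=
  match q with
  | 0 => atoms K v
  | q'.+1 => (atoms K v, [set ltp q' K [tuple of x :: v] | x : G])
  end.

Lemma tp_atoms_ltp q K n (v : n.-tuple G) : tp_atoms (ltp q K v) = atoms K v.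
Proof. by case: q. Qed.

Lemma ltpS q K n (v : n.-tuple G) :
  (ltp q.+1 K v).2 = [set ltp q K [tuple of x :: v] | x : G].
Proof. by []. Qed.

Lemma mem_tnth_a l : tnth a l \in A.
Proof. by rewrite inE mem_tnth. Qed.

Definition same_view K n (v v' : n.-tuple G) := forall i,
  tnth v i = tnth v' i \/ tnth v i \notin K :|: A /\ tnth v' i \notin K :|: A.

Lemma atoms_mask K n (v v' : n.-tuple G) : K \in components A ->
  same_view K v v' -> atoms K v = atoms K v'.
Proof.
move=> hK h.
have hp (x : point n) : pt v x = pt v' x \/
    pt v x \notin K :|: A /\ pt v' x \notin K :|: A.
  by case: x => x /=; [left | apply: h].
apply/setP=> i; rewrite [LHS]in_atoms [RHS]in_atoms.
case: i => [[[[[i|[x y]]|[i j]]|[i c]]|[i j]]|[[x y] B]] /=.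
- case: (h i) => [-> // | []]; rewrite !inE !negb_or => /andP[h1 _] /andP[h2 _].
  by rewrite (negPf h1) (negPf h2).
- case: (hp x) => [-> | [/negPf-> /negPf-> //]].
  case: (hp y) => [-> // | [hy hy']].
  case hx: (_ \in _) => //=; apply/eqP/eqP => e; last by rewrite -e hx in hy'.
  by rewrite -e hx in hy.
- case: (h i) => [-> | [/negPf-> /negPf-> //]].
  by case: (h j) => [-> // | [/negPf-> /negPf->]]; rewrite !andbF.
- by case: (h i) => [-> | [/negPf-> /negPf->]].
- by case: (h i) => [-> | [/negPf-> /negPf->]].
set D := [set tnth v i | i in B]; set D' := [set tnth v' i | i in B].
have eD : {in K :|: A, D =i D'}.
  move=> z hz; apply/imsetP/imsetP => -[i hi e]; exists i => //.
    by case: (h i) => [<- // | []]; rewrite -e hz.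
  by case: (h i) => [-> // | []]; rewrite -e hz.
rewrite (seg_mask _ _ hK eD); case: (hp x) => [-> | [hx hx']].
  by case: (hp y) => [-> // | [/negPf hy /negPf hy']]; rewrite /seg hy hy' !andbF.
by rewrite /seg (negPf hx) (negPf hx').
Qed.

Lemma same_view_cons K n (v v' : n.-tuple G) x x' : same_view K v v' ->
  x = x' \/ x \notin K :|: A /\ x' \notin K :|: A ->
  same_view K [tuple of x :: v] [tuple of x' :: v'].
Proof. by move=> h hx i; case: (unliftP ord0 i) => [j|] ->; rewrite ?tnth0 ?tnthS. Qed.

Lemma ltp_mask q K n (v v' : n.-tuple G) : K \in components A ->
  same_view K v v' -> ltp q K v = ltp q K v'.
Proof.
move=> hK; elim: q n v v' => [|q IH] n v v' h /=; rewrite (atoms_mask hK h) //.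
congr pair; apply: eq_imset => x; apply: IH.
by apply: same_view_cons => //; left.
Qed.

(* The type of [x :: v] is determined by that of [v] as soon as [C] describes the
   new vertex up to what [K] sees; [d] is a junk value. *)
Definition next q n (C : pred {set atom_idx n.+1}) (d : tp q n.+1)
    (t : tp q.+1 n) : tp q n.+1 :=
  odflt d [pick s in t.2 | C (tp_atoms s)].

Lemma next_ltp q n (C : pred {set atom_idx n.+1}) d K (v : n.-tuple G) z :
  C (atoms K [tuple of z :: v]) ->
  (forall y, C (atoms K [tuple of y :: v]) ->
     ltp q K [tuple of y :: v] = ltp q K [tuple of z :: v]) ->
  next C d (ltp q.+1 K v) = ltp q K [tuple of z :: v].
Proof.
move=> hz h; rewrite /next; case: pickP => [s|] /=.
  by case/andP=> /imsetP[y _ ->]; rewrite tp_atoms_ltp; apply: h.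
move/(_ (ltp q K [tuple of z :: v])); rewrite tp_atoms_ltp hz andbT.
by move/negbT/negP=> []; apply: imset_f.
Qed.

Definition profile q (X : {set G}) n (v : n.-tuple G) :=
  [seq (ltp q K v, K :&: X != set0) | K <- components A].

Lemma profile_cons_in q X n (v : n.-tuple G) l d :
  profile q X [tuple of tnth a l :: v] =
  map (fun t => (next (fun s => atom_eq (inr ord0) (inl l) \in s) d t.1, t.2))
    (profile q.+1 X v).
Proof.
rewrite /profile -map_comp; apply: eq_map => K /=.
rewrite -(@next_ltp q n (fun s => atom_eq (inr ord0) (inl l) \in s) d K v) //.
  by rewrite inE /= tnth0 eqxx andbT inE mem_tnth_a orbT.
by move=> y; rewrite inE /= tnth0 => /andP[_ /eqP->].
Qed.

Definition next_out q n := @next q n (fun s => atom_eq (inr ord0) (inr ord0) \notin s).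

Lemma ltp_cons_out q K n (v : n.-tuple G) z d : K \in components A ->
  z \notin K :|: A -> next_out d (ltp q.+1 K v) = ltp q K [tuple of z :: v].
Proof.
move=> hK hz; apply: next_ltp; rewrite ?inE /= ?tnth0 ?eqxx ?andbT // => y.
rewrite inE /= tnth0 eqxx andbT => hy; apply: ltp_mask => //.
by apply: same_view_cons; [left | right].
Qed.

Lemma profile_cons_out q X n (v : n.-tuple G) z K d : K \in components A ->
  z \in K ->
  perm_eq ((ltp q K [tuple of z :: v], K :&: X != set0) ::
      map (fun t => (next_out d t.1, t.2))
        [seq (ltp q.+1 L v, L :&: X != set0) | L <- rem K (components A)])
    (profile q X [tuple of z :: v]).
Proof.
move=> hK hz; rewrite /profile.
rewrite (perm_trans _ (perm_map _ (_ : perm_eq (K :: rem K (components A)) _))) //;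
  last by rewrite perm_sym perm_to_rem.
rewrite /= perm_cons -map_comp.
rewrite (_ : map _ _ = [seq (ltp q L [tuple of z :: v], L :&: X != set0)
  | L <- rem K (components A)]) //; apply/eq_in_map => L /=.
rewrite (mem_rem_uniq _ (uniq_components _)) inE => /andP[hLK hL].
rewrite -(@ltp_cons_out q L n v z d) // inE negb_or (components_notin hK hz) andbT.
by apply: contra hLK => hzL; rewrite (components_component hL hzL) (components_component hK hz).
Qed.

Lemma profile_step M q X X' n (v v' : n.-tuple G) z :
  {in A, X =i X'} ->
  capped_eq M.+2 (profile q.+1 X v) (profile q.+1 X' v') ->
  exists z', capped_eq M.+1 (profile q X [tuple of z :: v])
                            (profile q X' [tuple of z' :: v']).
Proof.
move=> hA h; have [hz|hz] := boolP (z \in A).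
  have /tnthP[l ->] : z \in a by rewrite inE in hz.
  exists (tnth a l).
  pose d := ltp q set0 [tuple of z :: v].
  rewrite !(profile_cons_in _ _ _ d); apply: capped_eq_map.
  exact: capped_eq_weak h.
have hK := component_components hz; have hzK := mem_component hz.
set K := component A z in hK hzK *; pose f X q (v : n.-tuple G) L := (ltp q L v, L :&: X != set0).
have : f X q.+1 v K \in profile q.+1 X' v'.
  by rewrite -(capped_eq_mem h); apply: map_f.
case/mapP=> K' hK' eK.
have eT : ltp q.+1 K v = ltp q.+1 K' v' := congr1 fst eK.
have eb : (K :&: X != set0) = (K' :&: X' != set0) := congr1 snd eK.
have : ltp q K [tuple of z :: v] \in (ltp q.+1 K' v').2.
  by rewrite -eT ltpS; apply: imset_f.
rewrite ltpS => /imsetP[z' _ ez]; exists z'.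
have hzK' : z' \in K'.
  have := congr1 (@tp_atoms q n.+1) ez; rewrite !tp_atoms_ltp.
  move/setP/(_ (atom_in ord0)); rewrite [LHS]in_atoms [RHS]in_atoms /=.
  by rewrite !tnth0 hzK => <-.
pose d := ltp q set0 [tuple of z :: v].
apply: (capped_eq_perm (profile_cons_out X v d hK hzK)
                       (profile_cons_out X' v' d hK' hzK')).
rewrite -ez -eb.
apply/capped_eq_cons/capped_eq_map/(@capped_eq_behead _ _ (f X q.+1 v K)).
rewrite {2}eK; apply: capped_eq_perm h.
  by rewrite -(map_cons (f X q.+1 v)); apply/perm_map/perm_to_rem.
by rewrite -(map_cons (f X' q.+1 v')); apply/perm_map/perm_to_rem.
Qed.
End LocalTypes.
Arguments atom_in {S p m n}.
Arguments atom_eq {S p m n}.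
Arguments atom_edge {S p m n}.
Arguments atom_color {S p m n}.
Arguments atom_mem {S p m n}.
Arguments atom_seg {S p m n}.

(** * Invariance of separator logic under equal capped profiles *)

Fixpoint quantifier_depth (S : finType) p n (f : sep S p n) : nat :=
  match f with
  | SNot _ f => quantifier_depth f
  | SAnd _ f g | SOr _ f g => maxn (quantifier_depth f) (quantifier_depth g)
  | SAll _ f | SEx _ f => (quantifier_depth f).+1
  | _ => 0
  end.

Section Swap.
Variables (S : finType) (p m : nat).
Variables (G : graph S) (w : p.-tuple {set G}) (a : m.-tuple G).
Let A : {set G} := [set x in a].
Implicit Types K X : {set G}.

Lemma visible x : exists2 K, K \in components A & x \in K :|: A.
Proof.
have [hx|hx] := boolP (x \in A).
  by exists set0; [rewrite inE eqxx | rewrite inE hx orbT].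
by exists (component A x); rewrite ?component_components // inE mem_component.
Qed.

Lemma has_atoms_eq n (v : n.-tuple G) i j :
  (tnth v i == tnth v j) =
  has (fun K => atom_eq (inr i) (inr j) \in atoms w a K v) (components A).
Proof.
apply/idP/hasP => [e|[K _]]; last by rewrite in_atoms => /andP[].
have [K hK hi] := visible (tnth v i); exists K => //.
by rewrite in_atoms /= e andbT.
Qed.

Lemma has_atoms_edge n (v : n.-tuple G) i j :
  edge (tnth v i) (tnth v j) =
  has (fun K => atom_edge i j \in atoms w a K v) (components A).
Proof.
apply/idP/hasP => [e|[K _]]; last by rewrite in_atoms => /and3P[].
suff [K hK /andP[hi hj]] : exists2 K, K \in components A &
    (tnth v i \in K :|: A) && (tnth v j \in K :|: A).
  by exists K => //; rewrite in_atoms /= e hi hj.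
have [hi|hi] := boolP (tnth v i \in A).
  have [K hK hj] := visible (tnth v j); exists K => //.
  by rewrite hj inE hi orbT.
exists (component A (tnth v i)); first by rewrite component_components.
apply/andP; split; first by rewrite inE mem_component.
rewrite in_setU; have [hj|hj] := boolP (tnth v j \in A); first by rewrite orbT.
by rewrite orbF inE sconn_edge.
Qed.

Lemma has_atoms_color n (v : n.-tuple G) i c :
  (tnth v i \in color c) =
  has (fun K => atom_color i c \in atoms w a K v) (components A).
Proof.
apply/idP/hasP => [e|[K _]]; last by rewrite in_atoms => /andP[].
have [K hK hi] := visible (tnth v i); exists K => //.
by rewrite in_atoms /= e andbT.
Qed.

Lemma has_atoms_mem n (v : n.-tuple G) i j :
  (tnth v i \in tnth w j) =
  has (fun K => atom_mem i j \in atoms w a K v) (components A).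
Proof.
apply/idP/hasP => [e|[K _]]; last by rewrite in_atoms => /andP[].
have [K hK hi] := visible (tnth v i); exists K => //.
by rewrite in_atoms /= e andbT.
Qed.

Definition atom_rel n (v : n.-tuple G) (B : {set 'I_n}) : rel (point m n) :=
  fun x y => has (fun K => atom_seg x y B \in atoms w a K v) (components A).

Lemma path_avoiding_atoms n (v : n.-tuple G) i j (s : seq 'I_n) :
  let R := atom_rel v [set l in s] in
  path_avoiding (tnth v i) (tnth v j) [seq tnth v l | l <- s] <->
  R (inr i) (inr i) && connect R (inr i) (inr j).
Proof.
move=> R; rewrite path_avoidingP.
have -> : [set z in [seq tnth v l | l <- s]] = [set tnth v l | l in [set l in s]].
  apply/setP=> z; rewrite inE; apply/mapP/imsetP => -[l hl ->]; exists l => //.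
    by rewrite inE.
  by rewrite inE in hl.
set B := [set tnth v l | l in _].
have eR : R =2 seg_rel A (pt a v) B.
  by move=> x y; apply: eq_has => K; rewrite in_atoms.
rewrite (@conn_segs _ _ A _ (pt a v) B (inr i) (inr j)).
  by rewrite eR (eq_connect eR).
by move=> x; rewrite inE => /tnthP[l ->]; exists (inl l).
Qed.

Definition respects X := forall K, K \in components A -> forall z, z \in K ->
  (z \in X) = (K :&: X != set0).

Lemma has_atoms_in X n (v : n.-tuple G) i : respects X ->
  (tnth v i \in X) =
  has (fun K => (atom_in i \in atoms w a K v) && (K :&: X != set0)) (components A) ||
  [exists l, (tnth a l \in X) &&
    has (fun K => atom_eq (inr i) (inl l) \in atoms w a K v) (components A)].
Proof.
move=> hX; apply/idP/orP => [hi|[|]].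
- have [hA|hA] := boolP (tnth v i \in A).
    right; have /tnthP[l el] : tnth v i \in a by rewrite inE in hA.
    apply/existsP; exists l; rewrite -el hi; apply/hasP.
    exists set0; first by rewrite inE eqxx.
    by rewrite in_atoms /= el eqxx andbT inE mem_tnth_a orbT.
  left; apply/hasP; exists (component A (tnth v i)); first by rewrite component_components.
  rewrite in_atoms /= mem_component //=.
  by rewrite -(hX _ (component_components hA) _ (mem_component hA)).
- by case/hasP=> K hK; rewrite in_atoms /= => /andP[hi]; rewrite -(hX _ hK _ hi).
case/existsP=> l /andP[hl /hasP[K _]]; rewrite in_atoms /= => /andP[_ /eqP e].
by rewrite e.
Qed.

Lemma has_profile M q n (v v' : n.-tuple G) X X' :
  capped_eq M.+1 (profile w a q X v) (profile w a q X' v') ->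
  forall R : {set atom_idx S p m n} -> bool -> bool,
  has (fun K => R (atoms w a K v) (K :&: X != set0)) (components A) =
  has (fun K => R (atoms w a K v') (K :&: X' != set0)) (components A).
Proof.
move=> h R.
have := eq_has_r (fun t => capped_eq_mem h t)
  (fun t => R (tp_atoms t.1) t.2); rewrite !has_map => e.
by apply: etrans (etrans e _); apply: eq_has => K /=; rewrite tp_atoms_ltp.
Qed.

Lemma has_profile_atom M q n (v v' : n.-tuple G) X X' i :
  capped_eq M.+1 (profile w a q X v) (profile w a q X' v') ->
  has (fun K => i \in atoms w a K v) (components A) =
  has (fun K => i \in atoms w a K v') (components A).
Proof. by move=> h; apply: (has_profile h (fun s _ => i \in s)). Qed.

Lemma profile_sat n (f : sep S p.+1 n) q (v v' : n.-tuple G) X X' :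
  quantifier_depth f <= q -> {in A, X =i X'} -> respects X -> respects X' ->
  capped_eq q.+1 (profile w a q X v) (profile w a q X' v') ->
  sep_sat [tuple of X :: w] f v <-> sep_sat [tuple of X' :: w] f v'.
Proof.
move=> hf hA hX hX'; elim: n / f q v v' hf => /=.
- move=> n x y q v v' _ h.
  have -> := (etrans (has_atoms_edge v x y) (etrans (has_profile_atom (atom_edge x y) h) (esym (has_atoms_edge v' x y)))).
  by [].
- move=> n x y q v v' _ h.
  suff e : (tnth v x == tnth v y) = (tnth v' x == tnth v' y).
    by split=> e'; apply/eqP; [rewrite -e | rewrite e]; apply/eqP.
  exact: (etrans (has_atoms_eq v x y) (etrans (has_profile_atom (atom_eq (inr x) (inr y)) h) (esym (has_atoms_eq v' x y)))).
- move=> n c x q v v' _ h.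
  have -> := (etrans (has_atoms_color v x c) (etrans (has_profile_atom (atom_color x c) h) (esym (has_atoms_color v' x c)))).
  by [].
- move=> n x Y q v v' _ h; case: (unliftP ord0 Y) => [j|] ->.
    rewrite [tnth (cons_tuple X w) _]tnthS [tnth (cons_tuple X' w) _]tnthS.
    have -> := (etrans (has_atoms_mem v x j) (etrans (has_profile_atom (atom_mem x j) h) (esym (has_atoms_mem v' x j)))).
    by [].
  rewrite [tnth (cons_tuple X w) _]tnth0 [tnth (cons_tuple X' w) _]tnth0.
  suff e : (tnth v x \in X) = (tnth v' x \in X') by rewrite e.
  have h1 := has_profile h (fun s b => (atom_in x \in s) && b).
  have h2 l : (tnth a l \in X) &&
      has (fun K => atom_eq (inr x) (inl l) \in atoms w a K v) (components A) =
    (tnth a l \in X') &&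
      has (fun K => atom_eq (inr x) (inl l) \in atoms w a K v') (components A).
    exact: (congr2 andb (hA _ (mem_tnth_a a l))
      (has_profile_atom (atom_eq (inr x) (inl l)) h)).
  exact: (etrans (has_atoms_in v x hX) (etrans (congr2 orb h1 (eq_existsb h2))
    (esym (has_atoms_in v' x hX')))).
- move=> n k s t l q v v' _ h.
  have ra : atom_rel v [set i in l] =2 atom_rel v' [set i in l].
    by move=> x y; apply: (has_profile_atom _ h).
  apply: iff_trans (path_avoiding_atoms v s t l) _.
  rewrite ra (eq_connect ra); exact: iff_sym (path_avoiding_atoms v' s t l).
- by move=> n f IH q v v' hf h; rewrite (IH q v v').
- move=> n f IHf g IHg q v v'; rewrite geq_max => /andP[hf hg] h.
  by rewrite (IHf q v v') // (IHg q v v').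
- move=> n f IHf g IHg q v v'; rewrite geq_max => /andP[hf hg] h.
  by rewrite (IHf q v v') // (IHg q v v').
- move=> n f IH [|q] v v' // hf h; split=> hx z.
    have [z' hz] := profile_step z (fun x hx => esym (hA x hx)) (capped_eq_sym h).
    by apply/(IH q _ _ hf (capped_eq_sym hz)).
  have [z' hz] := profile_step z hA h.
  by apply/(IH q _ _ hf hz).
- move=> n f IH [|q] v v' // hf h; split=> -[z hx].
    have [z' hz] := profile_step z hA h.
    by exists z'; apply/(IH q _ _ hf hz).
  have [z' hz] := profile_step z (fun x hx => esym (hA x hx)) (capped_eq_sym h).
  by exists z'; apply/(IH q _ _ hf (capped_eq_sym hz)).
Qed.

End Swap.

(** * Definability of local types *)

Section DefinableTypes.
Variables (S : finType) (p m : nat).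
Local Notation gpred n :=
  (forall G : graph S, p.-tuple {set G} -> n.-tuple G -> bool).

Lemma definable_andb n (P Q : gpred n) : definable P -> definable Q ->
  definable (fun G w v => P G w v && Q G w v).
Proof.
move=> hP hQ; apply: definable_iff (definable_and hP hQ) => G w v.
by split=> /andP.
Qed.

Lemma definable_orb n (P Q : gpred n) : definable P -> definable Q ->
  definable (fun G w v => P G w v || Q G w v).
Proof.
move=> hP hQ; apply: definable_iff (definable_or hP hQ) => G w v.
by split=> /orP.
Qed.

Lemma definable_negb n (P : gpred n) : definable P ->
  definable (fun G w v => ~~ P G w v).
Proof.
move=> hP; apply: definable_iff (definable_not hP) => G w v.
by split=> /negP.
Qed.

Lemma definable_addb n (P Q : gpred n) : definable P -> definable Q ->
  definable (fun G w v => P G w v (+) Q G w v).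
Proof.
move=> hP hQ; have h := definable_orb (definable_andb hP (definable_negb hQ))
  (definable_andb (definable_negb hP) hQ).
by apply: definable_iff h => G w v; case: (P G w v); case: (Q G w v).
Qed.

Lemma definable_eqb n (x y : 'I_n) :
  definable (fun (G : graph S) (w : p.-tuple {set G}) v => tnth v x == tnth v y).
Proof.
by apply: definable_iff (@definable_eq S p _ x y) => G w v; split=> /eqP.
Qed.

Lemma definable_existsb n (P : gpred n.+1) : definable P ->
  definable (fun G w v => [exists x, P G w [tuple of x :: v]]).
Proof.
by move=> hP; apply: definable_iff (definable_ex hP) => G w v; split=> /existsP.
Qed.

Lemma definable_existsb_fin n (T : finType) (P : T -> gpred n) :
  (forall i, definable (P i)) -> definable (fun G w v => [exists i, P i G w v]).
Proof.
move=> hP; apply: definable_iff (definable_ex_fin hP) => G w v.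
by split=> /existsP.
Qed.

Lemma definable_sconn n (x y : 'I_n) (s : seq 'I_n) :
  definable (fun (G : graph S) (w : p.-tuple {set G}) v =>
    sconn [set z in [seq tnth v i | i <- s]] (tnth v x) (tnth v y)).
Proof.
apply: definable_iff (@definable_path S p _ x y _ (in_tuple s)) => G w v.
exact: path_avoidingP.
Qed.

Local Notation sep_set alpha v := [set x in proj alpha v].

Lemma sep_setE (G : graph S) n (alpha : 'I_m -> 'I_n) (v : n.-tuple G) :
  sep_set alpha v = [set z in [seq tnth v i | i <- codom alpha]].
Proof.
apply/setP=> z; rewrite !inE; apply/tnthP/mapP => [[l ->]|[i /codomP[l ->] ->]].
  by rewrite tnth_mktuple; exists (alpha l) => //; apply: codom_f.
by exists l; rewrite tnth_mktuple.
Qed.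

Lemma definable_in_sep n (alpha : 'I_m -> 'I_n) z :
  definable (fun (G : graph S) (w : p.-tuple {set G}) v => tnth v z \in sep_set alpha v).
Proof.
apply: definable_iff (definable_existsb_fin (fun l => definable_eqb z (alpha l))).
move=> G w v; rewrite inE; split=> [/existsP[l /eqP->]|/tnthP[l e]].
  by apply/tnthP; exists l; rewrite tnth_mktuple.
by apply/existsP; exists l; rewrite e tnth_mktuple.
Qed.

Lemma definable_in_component n (alpha : 'I_m -> 'I_n) y z :
  definable (fun (G : graph S) (w : p.-tuple {set G}) v =>
    tnth v z \in component (sep_set alpha v) (tnth v y)).
Proof.
apply: definable_iff (definable_sconn y z (codom alpha)) => G w v.
by rewrite inE sep_setE.
Qed.

Lemma definable_in_component_sep n (alpha : 'I_m -> 'I_n) y z :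
  definable (fun (G : graph S) (w : p.-tuple {set G}) v =>
    tnth v z \in component (sep_set alpha v) (tnth v y) :|: sep_set alpha v).
Proof.
have := definable_orb (definable_in_component alpha y z) (definable_in_sep alpha z).
by apply: definable_iff => G w v; rewrite in_setU.
Qed.

Lemma definable_in_image n k (r : 'I_k -> 'I_n) (B : {set 'I_k}) z :
  definable (fun (G : graph S) (w : p.-tuple {set G}) v =>
    tnth v z \in [set tnth (proj r v) i | i in B]).
Proof.
have := definable_existsb_fin
  (fun i => definable_andb (@definable_const S p n (i \in B)) (definable_eqb z (r i))).
apply: definable_iff => G w v.
split=> [/existsP[i /andP[hi /eqP->]]|/imsetP[i hi ->]].
  by apply/imsetP; exists i; rewrite ?tnth_mktuple.
by apply/existsP; exists i; rewrite tnth_mktuple eqxx andbT.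
Qed.

Lemma definable_sconn_setU n k (alpha : 'I_m -> 'I_n) (r : 'I_k -> 'I_n)
    (B : {set 'I_k}) x y :
  definable (fun (G : graph S) (w : p.-tuple {set G}) v =>
    sconn (sep_set alpha v :|: [set tnth (proj r v) i | i in B])
      (tnth v x) (tnth v y)).
Proof.
have := definable_sconn x y (codom alpha ++ [seq r i | i <- enum B]).
apply: definable_iff => G w v.
suff -> : sep_set alpha v :|: [set tnth (proj r v) i | i in B] =
  [set z in [seq tnth v i | i <- codom alpha ++ [seq r i | i <- enum B]]] by [].
apply/setP=> z; rewrite in_setU [RHS]inE map_cat mem_cat sep_setE inE; congr orb.
rewrite -map_comp; apply/imsetP/mapP => -[i hi ->]; exists i => //=.
- by rewrite mem_enum.
- by rewrite tnth_mktuple.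
- by rewrite -mem_enum.
by rewrite tnth_mktuple.
Qed.

Lemma definable_seg n k (alpha : 'I_m -> 'I_n) (r : 'I_k -> 'I_n)
    (B : {set 'I_k}) z x y :
  definable (fun (G : graph S) (w : p.-tuple {set G}) v =>
    seg (sep_set alpha v) (component (sep_set alpha v) (tnth v z))
      [set tnth (proj r v) i | i in B] (tnth v x) (tnth v y)).
Proof.
pose s (i : 'I_n) : 'I_n.+2 := lift ord0 (lift ord0 i).
pose c0 : 'I_n.+2 := ord0; pose c1 : 'I_n.+2 := lift ord0 ord0.
have body := definable_andb (definable_in_component (s \o alpha) (s z) c1)
  (definable_andb (definable_in_component (s \o alpha) (s z) c0)
  (definable_andb (definable_orb (definable_eqb (s x) c1)
      (@definable_edge S p _ (s x) c1))
  (definable_andb (definable_orb (definable_eqb c0 (s y))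
      (@definable_edge S p _ c0 (s y)))
    (definable_sconn_setU (s \o alpha) (s \o r) B c1 c0)))).
have proj_s (G : graph S) l (f : 'I_l -> 'I_n) (v : n.-tuple G) t u :
    proj (s \o f) [tuple of u :: [tuple of t :: v]] = proj f v.
  by apply: eq_from_tnth => i; rewrite !tnth_mktuple !tnthS.
have path_part : definable (fun (G : graph S) (w : p.-tuple {set G}) v =>
    let A := sep_set alpha v in let K := component A (tnth v z) in
    [exists u, exists u', [&& u \in K, u' \in K,
      (tnth v x == u) || edge (tnth v x) u, (u' == tnth v y) || edge u' (tnth v y) &
      sconn (A :|: [set tnth (proj r v) i | i in B]) u u']]).
  apply: definable_iff (definable_existsb (definable_existsb body)) => G w v.
  have t0 t u : tnth [tuple of u :: [tuple of t :: v]] c0 = u by [].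
  have t1 t u : tnth [tuple of u :: [tuple of t :: v]] c1 = t.
    by rewrite tnthS.
  have ts t u i : tnth [tuple of u :: [tuple of t :: v]] (s i) = tnth v i.
    by rewrite !tnthS.
  split=> /existsP[t /existsP[u h]]; apply/existsP; exists t; apply/existsP; exists u.
    by move: h; rewrite !ts !t0 !t1 !proj_s.
  by rewrite !ts !t0 !t1 !proj_s.
have := definable_andb (definable_in_component_sep alpha z x)
  (definable_andb (definable_in_component_sep alpha z y)
  (definable_andb (definable_negb (definable_in_image r B x))
  (definable_andb (definable_negb (definable_in_image r B y))
  (definable_orb (definable_eqb x y)
  (definable_orb (@definable_edge S p _ x y) path_part))))).
by apply: definable_iff.
Qed.

Definition point_ren n k (alpha : 'I_m -> 'I_n) (r : 'I_k -> 'I_n)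
    (x : point m k) : 'I_n :=
  match x with inl l => alpha l | inr i => r i end.

Lemma pt_proj (G : graph S) n k (alpha : 'I_m -> 'I_n) (r : 'I_k -> 'I_n)
    (v : n.-tuple G) x :
  pt (proj alpha v) (proj r v) x = tnth v (point_ren alpha r x).
Proof. by case: x => i; rewrite /= tnth_mktuple. Qed.

Lemma definable_atom n k (alpha : 'I_m -> 'I_n) (r : 'I_k -> 'I_n) z
    (i : atom_idx S p m k) :
  definable (fun (G : graph S) (w : p.-tuple {set G}) v =>
    atom w (proj alpha v) (component (sep_set alpha v) (tnth v z)) (proj r v) i).
Proof.
have vis x := definable_in_component_sep alpha z x.
case: i => [[[[[i|[x y]]|[i j]]|[i c]]|[i j]]|[[x y] B]].
- apply: definable_iff (definable_in_component alpha z (r i)) => G w v /=.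
  by rewrite tnth_mktuple.
- apply: definable_iff (definable_andb (vis (point_ren alpha r x)) (definable_eqb
    (point_ren alpha r x) (point_ren alpha r y))) => G w v /=.
  by rewrite !pt_proj.
- apply: definable_iff (definable_andb (vis (r i)) (definable_andb (vis (r j))
    (@definable_edge S p _ (r i) (r j)))) => G w v /=.
  by rewrite !(tnth_mktuple, tnth_map).
- apply: definable_iff (definable_andb (vis (r i))
    (@definable_color S p _ c (r i))) => G w v /=.
  by rewrite tnth_mktuple.
- apply: definable_iff (definable_andb (vis (r i))
    (@definable_mem S p _ (r i) j)) => G w v /=.
  by rewrite tnth_mktuple.
apply: definable_iff (definable_seg alpha r B z (point_ren alpha r x)
  (point_ren alpha r y)) => G w v /=.
by rewrite !pt_proj.
Qed.

Lemma definable_ltp q n k (alpha : 'I_m -> 'I_n) (r : 'I_k -> 'I_n) z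
    (t : tp S p m q k) :
  definable (fun (G : graph S) (w : p.-tuple {set G}) v =>
    ltp w (proj alpha v) q (component (sep_set alpha v) (tnth v z)) (proj r v) = t).
Proof.
elim: q n k alpha r z t => [|q IH] n k alpha r z t.
  exact: definable_set_eq (definable_atom alpha r z) t.
case: t => t1 t2.
have h1 := definable_set_eq (definable_atom alpha r z) t1.
have h2 : definable (fun (G : graph S) (w : p.-tuple {set G}) v =>
    [set ltp w (proj alpha v) q (component (sep_set alpha v) (tnth v z))
       [tuple of x :: proj r v] | x : G] = t2).
  have h := definable_all_fin (fun s => definable_equiv
    (definable_ex (IH _ _ (lift ord0 \o alpha) (lift_ren r) (lift ord0 z) s))
    (@definable_const S p n (s \in t2))).
  apply: definable_iff h => G w v.
  have e x : ltp w (proj (lift ord0 \o alpha) [tuple of x :: v]) q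
      (component (sep_set (lift ord0 \o alpha) [tuple of x :: v])
        (tnth [tuple of x :: v] (lift ord0 z)))
      (proj (lift_ren r) [tuple of x :: v]) =
    ltp w (proj alpha v) q (component (sep_set alpha v) (tnth v z))
       [tuple of x :: proj r v].
    by rewrite proj_cons proj_lift tnthS.
  split=> [h|<- s]; last first.
    split=> [[x hx]|/imsetP[x _ ->]]; last by exists x.
    by rewrite -hx e; apply: imset_f.
  apply/setP=> s; apply/imsetP/idP => [[x _ ->]|/(h s)[x hx]].
    by apply/h; exists x.
  by exists x; rewrite // -e.
apply: definable_iff (definable_and h1 h2) => G w v /=.
by split=> [[<- <-]|[<- <-]].
Qed.

(* Components whose type is in [full] are selected, except those meeting [b];
   of the other components, only those meeting [b] are selected. *)
Definition selection (G : graph S) (w : p.-tuple {set G}) (a : m.-tuple G) N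
    (b : N.-tuple G) n (v : n.-tuple G) q (I : {set 'I_m})
    (full : {set tp S p m q n}) : {set G} :=
  let A := [set x in a] in
  [set z | [exists l, (l \in I) && (z == tnth a l)] ||
    (z \notin A) && ((ltp w a q (component A z) v \in full) (+)
                    [exists j, tnth b j \in component A z])].

Lemma definable_selection n k N q (alpha : 'I_m -> 'I_n) (beta : 'I_N -> 'I_n)
    (r : 'I_k -> 'I_n) I (full : {set tp S p m q k}) z :
  definable (fun (G : graph S) (w : p.-tuple {set G}) v =>
    tnth v z \in selection w (proj alpha v) (proj beta v) (proj r v) I full).
Proof.
have h1 := definable_existsb_fin (fun l => definable_andb
  (@definable_const S p n (l \in I)) (definable_eqb z (alpha l))).
have h2 : definable (fun (G : graph S) (w : p.-tuple {set G}) v =>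
  ltp w (proj alpha v) q (component (sep_set alpha v) (tnth v z)) (proj r v)
    \in full).
  have := definable_ex_fin (fun t => definable_and
    (@definable_const S p n (t \in full)) (definable_ltp alpha r z t)).
  apply: definable_iff => G w v; split=> [[t [ht ->]] // | ht].
  by eexists; split; first exact: ht.
have h3 := definable_existsb_fin
  (fun j => definable_in_component alpha z (beta j)).
have := definable_orb h1 (definable_andb (definable_negb (definable_in_sep alpha z))
  (definable_addb h2 h3)).
apply: definable_iff => G w v; rewrite [_ \in selection _ _ _ _ _ _]inE.
have -> : [exists l, (l \in I) && (tnth v z == tnth (proj alpha v) l)] =
          [exists l, (l \in I) && (tnth v z == tnth v (alpha l))].
  by apply: eq_existsb => l; rewrite tnth_mktuple.
have -> : [exists j, tnth (proj beta v) j \in component (sep_set alpha v) (tnth v z)]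
  = [exists j, tnth v (beta j) \in component (sep_set alpha v) (tnth v z)].
  by apply: eq_existsb => j; rewrite tnth_mktuple.
by [].
Qed.

End DefinableTypes.

(** * Selecting components *)

Section Selection.
Variables (S : finType) (p m : nat).
Variables (G : graph S) (w : p.-tuple {set G}) (a : m.-tuple G).
Let A : {set G} := [set x in a].
Implicit Types K X : {set G}.

Lemma edge_closed_respects X :
  (forall x y, x \notin A -> y \notin A -> edge x y -> (x \in X) = (y \in X)) ->
  respects a X.
Proof.
move=> hX.
have conn x y : sconn A x y -> (x \in X) = (y \in X).
  case/andP=> _ /connectP[s hs ->]; elim: s x hs => //= z s IH x.
  by case/andP=> /and3P[e hx hz] /IH <-; apply: hX.
move=> K hK z hz; apply/idP/set0Pn => [hzX|[y]].
  by exists z; rewrite inE hz.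
rewrite inE => /andP[hy hyX]; rewrite (@conn z y) //.
by rewrite -(components_conn _ hK hz).
Qed.

Lemma selection_component N (b : N.-tuple G) n (v : n.-tuple G) q I
    (full : {set tp S p m q n}) K z : K \in components A -> z \in K ->
  (z \in @selection S p m G w a N b n v q I full) =
  (ltp w a q K v \in full) (+) [exists j, tnth b j \in K].
Proof.
move=> hK hz; have hzA := components_notin hK hz.
rewrite inE hzA -(components_component hK hz) /=.
case: existsP => // -[l /andP[_ /eqP e]].
by rewrite e inE mem_tnth in hzA.
Qed.

Lemma constant_respects X (c : {set G} -> bool) :
  (forall K z, K \in components A -> z \in K -> (z \in X) = c K) -> respects a X.
Proof.
move=> hc K hK z hz; rewrite (hc _ _ hK hz); apply/idP/set0Pn => [h|[y]].
  by exists z; rewrite inE hz (hc _ _ hK hz).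
by rewrite inE => /andP[hy]; rewrite (hc _ _ hK hy).
Qed.

Lemma selection_equiv M q n (v : n.-tuple G) X : respects a X ->
  exists2 N, N <= M * #|tp S p m q n| &
  exists (b : N.-tuple G) (I : {set 'I_m}) (full : {set tp S p m q n}),
    let X' := selection w a b v I full in
    [/\ {in A, X =i X'}, respects a X' &
      capped_eq M (profile w a q X v) (profile w a q X' v)].
Proof.
move=> hX; set CS := [set component A y | y in ~: A].
have hCS K : K \in CS -> K \in components A.
  by rewrite in_cons mem_enum orbC => ->.
have [E [full [sE cE hE]]] := capped_choice M CS (fun K => ltp w a q K v)
  (fun K => K :&: X != set0).
have inCS K z : K \in components A -> z \in K -> K \in CS.
  by rewrite in_cons mem_enum => /orP[/eqP-> | //]; rewrite inE.
have neE K : K \in CS -> exists z, z \in K.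
  by case/imsetP=> y; rewrite inE => hy ->; exists y; apply: mem_component.
pose bs := pmap (fun K => [pick z in K]) (enum E).
have hbs K : K \in CS -> [exists j, tnth (in_tuple bs) j \in K] = (K \in E).
  move=> hK; apply/existsP/idP => [[j hj]|hKE].
    have := mem_tnth j (in_tuple bs); rewrite mem_pmap => /mapP[L].
    rewrite mem_enum => hL; case: pickP => // z hz [e].
    rewrite e in hj; rewrite (components_component (hCS _ hK) hj).
    by rewrite -(components_component (hCS _ (subsetP sE _ hL)) hz).
  have [z hz] := neE K hK.
  have [y hy hyK] : exists2 y, [pick z in K] = Some y & y \in K.
    by case: pickP => [y hy|/(_ z)]; [exists y | rewrite hz].
  have /tnthP[j hj] : y \in in_tuple bs.
    by rewrite mem_pmap; apply/mapP; exists K; rewrite ?mem_enum.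
  by exists j; rewrite -hj.
exists (size bs).
  by apply: leq_trans cE; rewrite size_pmap cardE count_size.
exists (in_tuple bs), [set l | tnth a l \in X], full => X'.
have hX' K z : K \in components A -> z \in K ->
    (z \in X') = (ltp w a q K v \in full) (+) (K \in E).
  move=> hK hz; rewrite (selection_component _ _ _ _ hK hz) hbs //.
  exact: inCS hK hz.
have rX' : respects a X'.
  by apply: (@constant_respects _ (fun K => (ltp w a q K v \in full) (+) (K \in E))).
split=> // [x hx|].
  rewrite /X' /selection inE hx /= orbF.
  have /tnthP[l e] : x \in a by rewrite inE in hx.
  apply/idP/existsP => [hxX|[l' /andP[]]]; last by rewrite inE => hl /eqP->.
  by exists l; rewrite inE -e hxX eqxx.
rewrite /profile /components /= !set0I eqxx; apply: capped_eq_cons.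
suff <- : [seq (ltp w a q K v, (ltp w a q K v \in full) (+) (K \in E)) | K <- enum CS]
  = [seq (ltp w a q K v, K :&: X' != set0) | K <- enum CS] by [].
apply/eq_in_map => K; rewrite mem_enum => hK; have [z hz] := neE K hK.
by rewrite -(rX' _ (hCS K hK) z hz) (hX' _ _ (hCS K hK) hz).
Qed.
End Selection.

(** * Cut rank *)

Section Minors.
Variable F : fieldType.

Lemma mxrank_mxsub_leq m n k l (M : 'M[F]_(m, n)) (f : 'I_k -> 'I_m)
    (g : 'I_l -> 'I_n) : \rank (mxsub f g M) <= \rank M.
Proof.
rewrite mxsubrc; apply: leq_trans (mxrankS (rowsub_sub _ _)) _.
rewrite -mxrank_tr trmx_mxsub -[leqRHS]mxrank_tr.
exact: mxrankS (rowsub_sub _ _).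
Qed.

Lemma row_free_rowsub m n k (M : 'M[F]_(m, n)) (f : 'I_k -> 'I_m) :
  injective f -> row_free M -> row_free (rowsub f M).
Proof.
move=> inj_f /row_freeP[B hB]; apply/row_freeP; exists (colsub f B).
apply/matrixP => i j; rewrite mul_rowsub_mx mulmx_colsub hB !mxE.
by rewrite (inj_eq inj_f).
Qed.

Lemma unit_minorP m n k (M : 'M[F]_(m, n)) :
  reflect (exists (f : 'I_k -> 'I_m) (g : 'I_k -> 'I_n), mxsub f g M \in unitmx)
          (k <= \rank M).
Proof.
apply: (iffP idP) => [hk|[f [g]]]; last first.
  by rewrite -row_free_unit => /eqP <-; apply: mxrank_mxsub_leq.
pose f := maxrankfun M \o widen_ord hk.
have ff : row_free (rowsub f M).
  rewrite rowsub_comp; apply: row_free_rowsub (maxrowsub_free M).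
  by move=> i j /(congr1 val) /= e; apply: val_inj.
have fT : row_full (rowsub f M)^T%R by rewrite /row_full mxrank_tr.
move: (fullrankfun fT) (fullrowsub_unit fT) => g hg; exists f, g.
by rewrite mxsubcr -unitmx_tr trmx_mxsub.
Qed.

End Minors.

Section Rank.
Variable S : finType.

Lemma cutrank_gtP (G : graph S) (X : {set G}) r :
  r < cutrank X <-> exists (N : 'M['F_2]_r.+1) (x y : r.+1.-tuple G),
    N \in unitmx /\ forall i j, [/\ tnth x i \in X, tnth y j \notin X &
      N i j = (edge (tnth x i) (tnth y j))%:R%R].
Proof.
split=> [/unit_minorP[f [g h]]|[N [x [y [hN h]]]]].
  exists (mxsub f g (cut_matrix X)), [tuple enum_val (f i) | i < r.+1],
    [tuple enum_val (g i) | i < r.+1]; split=> // i j.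
  rewrite !tnth_mktuple !mxE enum_valP; split=> //.
  by have := enum_valP (g j); rewrite inE.
have hx i : tnth x i \in X by case: (h i i).
have hy j : tnth y j \in ~: X by case: (h j j); rewrite inE.
apply/unit_minorP; exists (fun i => enum_rank_in (hx i) (tnth x i)),
  (fun j => enum_rank_in (hy j) (tnth y j)).
suff -> : mxsub (fun i => enum_rank_in (hx i) (tnth x i))
  (fun j => enum_rank_in (hy j) (tnth y j)) (cut_matrix X) = N by [].
apply/matrixP => i j; rewrite !mxE !enum_rankK_in //.
by case: (h i j).
Qed.

Lemma definable_cutrank p n r :
  definable (fun (G : graph S) (w : p.+1.-tuple {set G}) (v : n.-tuple G) =>
    cutrank (tnth w ord0) <= r).
Proof.
pose k := r.+1.
pose sx (i : 'I_k) : 'I_(k + (k + n)) := lshift _ i.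
pose sy (i : 'I_k) : 'I_(k + (k + n)) := rshift _ (lshift _ i).
have edge_bit (N : 'M['F_2]_k) i j : definable (fun (G : graph S)
    (w : p.+1.-tuple {set G}) (u : (k + (k + n)).-tuple G) =>
    N i j = (edge (tnth u (sx i)) (tnth u (sy j)))%:R%R).
  have he := @definable_edge S p.+1 _ (sx i) (sy j).
  have hc b := @definable_const S p.+1 (k + (k + n)) (N i j = (b : bool)%:R%R).
  have := definable_or (definable_and he (hc true))
    (definable_and (definable_not he) (hc false)).
  apply: definable_iff => G w u; case: (edge _ _); split=> [[[]|[]] // | e].
    by left.
  by right; split.
have entry (N : 'M['F_2]_k) i j := definable_and
  (@definable_mem S p.+1 (k + (k + n)) (sx i) ord0)
  (definable_and (definable_not (@definable_mem S p.+1 _ (sy j) ord0))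
    (edge_bit N i j)).
have entries N := definable_all_fin (fun i => definable_all_fin (entry N i)).
have := definable_not (definable_ex_fin (fun N => definable_and
  (@definable_const S p.+1 n (N \in unitmx))
  (definable_ex_tuple (definable_ex_tuple (entries N))))).
apply: definable_iff => G w v; rewrite leqNgt; split=> h.
  apply/negP => /cutrank_gtP[N [x [y [hN hxy]]]]; apply: h.
  exists N; split=> //; exists y, x => i j; have [hx hy e] := hxy i j.
  by rewrite !tnth_lshift !tnth_rshift tnth_lshift; split=> //; split=> //; apply/negP.
move=> [N [hN [y [x hxy]]]]; move/negP: h; apply; apply/cutrank_gtP.
exists N, x, y; split=> // i j; move: (hxy i j).
by rewrite !tnth_lshift !tnth_rshift tnth_lshift => -[? [/negP ? ?]].
Qed.

End Rank.

Section Cover.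
Variables (S : finType) (G : graph S) (X : {set G}).

Lemma card_rows m n (M : 'M['F_2]_(m, n)) :
  #|[set row i M | i : 'I_m]| <= 2 ^ \rank M.
Proof.
have sub : [set row i M | i : 'I_m] \subset
    [set u *m row_base M | u : 'rV['F_2]_(\rank M)]%R.
  apply/subsetP => _ /imsetP[i _ ->].
  have /submxP[u ->] : (row i M <= row_base M)%MS by rewrite eq_row_base row_sub.
  exact: imset_f.
apply: leq_trans (subset_leq_card sub) (leq_trans (leq_imset_card _ _) _).
by rewrite card_mx mul1n card_Fp.
Qed.

Definition trace (Y : {set G}) (x : G) := [set y in Y | edge x y].

Lemma card_traces (Y Z : {set G}) (M : 'M['F_2]_(#|Y|, #|Z|)) :
  (forall i j, M i j = (edge (enum_val i) (enum_val j))%:R%R) ->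
  #|[set trace Z x | x in Y]| <= 2 ^ \rank M.
Proof.
move=> hM; apply: leq_trans (card_rows _).
pose f (u : 'rV['F_2]_#|Z|) := [set enum_val j | j in [set j | u ord0 j != 0%R]].
apply: leq_trans (leq_imset_card f _); apply: subset_leq_card.
apply/subsetP => _ /imsetP[x hx ->]; apply/imsetP.
exists (row (enum_rank_in hx x) M); first exact: imset_f.
apply/setP=> y; rewrite inE; apply/andP/imsetP => [[hy e]|[j]].
  exists (enum_rank_in hy y); last by rewrite enum_rankK_in.
  by rewrite inE mxE hM !enum_rankK_in // e.
rewrite inE mxE hM enum_rankK_in // => hj ->; split; first exact: enum_valP.
by case: edge hj.
Qed.

Variables (t r : nat).
Hypothesis (hX : cutrank X <= r).

Definition small_classes (Y Z : {set G}) :=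
  \bigcup_(P in [set trace Z x | x in Y])
    if #|[set x in Y | trace Z x == P]| < t then [set x in Y | trace Z x == P]
    else set0.

Lemma card_small_classes (Y Z : {set G}) : #|[set trace Z x | x in Y]| <= 2 ^ r ->
  #|small_classes Y Z| <= 2 ^ r * t.
Proof.
move=> h; apply: leq_trans (_ : #|[set trace Z x | x in Y]| * t <= _); last first.
  by rewrite leq_mul2r h orbT.
rewrite -sum_nat_const /small_classes.
elim/big_ind2: _ => [|B b C c hB hC|P _]; first by rewrite cards0.
  by apply: leq_trans (leq_card_setU _ _) _; apply: leq_add.
by case: ltnP => [/ltnW //|_]; rewrite cards0.
Qed.

Lemma notin_small_classes (Y Z : {set G}) x : x \in Y ->
  x \notin small_classes Y Z -> t <= #|[set x' in Y | trace Z x' == trace Z x]|.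
Proof.
move=> hx; apply: contraR; rewrite -ltnNge => h; apply/bigcupP.
by exists (trace Z x); [exact: imset_f | rewrite h inE hx eqxx].
Qed.

Lemma cut_cover : ~ contains_Ktt G t ->
  exists2 A : {set G}, #|A| <= 2 ^ r * t + 2 ^ r * t &
    forall x y, x \notin A -> y \notin A -> edge x y -> (x \in X) = (y \in X).
Proof.
move=> nK; exists (small_classes X (~: X) :|: small_classes (~: X) X).
  apply: leq_trans (leq_card_setU _ _) _; apply: leq_add; apply: card_small_classes.
    apply: leq_trans (leq_pexp2l _ hX) => //.
    by apply: card_traces => i j; rewrite mxE.
  apply: leq_trans (leq_pexp2l _ hX) => //; rewrite /cutrank -mxrank_tr.
  by apply: card_traces => i j; rewrite !mxE edge_sym.
suff main x y : x \in X -> y \notin X -> edge x y ->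
    (x \in small_classes X (~: X)) || (y \in small_classes (~: X) X).
  move=> x y; rewrite !inE !negb_or => /andP[x1 x2] /andP[y1 y2] e.
  case hx: (x \in X); case hy: (y \in X) => //.
    by have := main x y hx (negbT hy) e; rewrite (negPf x1) (negPf y2).
  by rewrite edge_sym in e; have := main y x hy (negbT hx) e;
    rewrite (negPf y1) (negPf x2).
move=> hx hy e; rewrite -[_ || _]negbK negb_or; apply/negP => /andP[hxs hys].
have hyC : y \in ~: X by rewrite inE.
have hC := notin_small_classes hx hxs; have hD := notin_small_classes hyC hys.
set C := [set x' in X | _] in hC; set D := [set y' in ~: X | _] in hD.
have CP u : u \in C -> u \in X /\ trace (~: X) u = trace (~: X) x.
  by rewrite inE => /andP[-> /eqP].
have DP u : u \in D -> u \notin X /\ trace X u = trace X y.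
  by rewrite !inE => /andP[-> /eqP].
have CD u z : u \in C -> z \in D -> edge u z.
  move=> /CP[hu eu] /DP[hz ez].
  have : y \in trace (~: X) u by rewrite eu !inE hy.
  rewrite inE => /andP[_ uy].
  have : u \in trace X z by rewrite ez inE hu edge_sym.
  by rewrite inE edge_sym => /andP[].
apply: nK; exists (fun i => match i with
  | inl i => enum_val (widen_ord hC i) | inr j => enum_val (widen_ord hD j) end).
split=> [[i|i] [j|j] /= e'|[i|i] [j|j] //= _].
- by congr inl; apply: val_inj; case/enum_val_inj: e'.
- have [+ _] := CP _ (enum_valP (widen_ord hC i)).
  by rewrite e'; have [/negPf-> _] := DP _ (enum_valP (widen_ord hD j)).
- have [+ _] := CP _ (enum_valP (widen_ord hC j)).
  by rewrite -e'; have [/negPf-> _] := DP _ (enum_valP (widen_ord hD i)).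
- by congr inr; apply: val_inj; case/enum_val_inj: e'.
- by apply: CD; apply: enum_valP.
by rewrite edge_sym; apply: CD; apply: enum_valP.
Qed.
End Cover.

(** * Eliminating set quantifiers *)

Section SetElimination.
Variables (S : finType) (p n : nat).

Lemma definable_sat_selection m N q (f : sep S p.+1 n) I
    (full : {set tp S p m q n}) :
  definable (fun (G : graph S) (w : p.-tuple {set G}) (v : n.-tuple G) =>
    exists (a : m.-tuple G) (b : N.-tuple G),
      sep_sat [tuple of selection w a b v I full :: w] f v).
Proof.
pose ib (j : 'I_N) : 'I_(N + (m + n)) := lshift _ j.
pose ia (l : 'I_m) : 'I_(N + (m + n)) := rshift _ (lshift _ l).
pose iv (i : 'I_n) : 'I_(N + (m + n)) := rshift _ (rshift _ i).
have [f' hf'] := definable_ren iv (definable_sat f).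
pose D (G : graph S) (w : p.-tuple {set G}) (u : (N + (m + n)).-tuple G) :=
  selection w (proj ia u) (proj ib u) (proj iv u) I full.
have proj_behead (G : graph S) k (g : 'I_k -> 'I_(N + (m + n)))
    (u : (N + (m + n)).+1.-tuple G) :
    proj (fun i => lift ord0 (g i)) u = proj g (behead_tuple u).
  by case/tupleP: u => x u; rewrite proj_lift behead_cons.
have hD : definable (fun G w (u : (N + (m + n)).+1.-tuple G) =>
    thead u \in D G w (behead_tuple u)).
  have := definable_selection (fun i => lift ord0 (ia i))
    (fun i => lift ord0 (ib i)) (fun i => lift ord0 (iv i)) I full ord0.
  by apply: definable_iff => G w u; rewrite !proj_behead.
have := definable_ex_tuple (definable_ex_tuple (definable_subst f' hD)).
apply: definable_iff => G w v.
have e (a : m.-tuple G) (b : N.-tuple G) (u := [tuple of b ++ [tuple of a ++ v]]) :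
    [/\ proj ia u = a, proj ib u = b & proj iv u = v].
  split; apply: eq_from_tnth => i; rewrite tnth_mktuple /u.
  - by rewrite tnth_rshift tnth_lshift.
  - by rewrite tnth_lshift.
  by rewrite !tnth_rshift.
split=> -[a [b h]]; exists a, b; have [ea eb ev] := e a b.
  by move: h; rewrite -hf' /D ea eb ev.
by rewrite -hf' /D ea eb ev.
Qed.

Lemma set_quantifier_elimination (C : graph S -> Prop) r (f : sep S p.+1 n) :
  weakly_sparse C -> exists g : sep S p n, 
    forall G : graph S, C G -> forall (v : n.-tuple G) (w : p.-tuple {set G}),
    (exists X : {set G}, cutrank X <= r /\ sep_sat [tuple of X :: w] f v) <->
    sep_sat w g v.
Proof.
case=> t hC.
have [f' hf'] := definable_and (definable_cutrank S p n r) (definable_sat f).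
pose q := quantifier_depth f'; pose bound := 2 ^ r * t + 2 ^ r * t.
have [g hg] := definable_ex_fin (fun m : 'I_bound.+1 =>
  definable_ex_fin (fun N : 'I_(q.+1 * #|tp S p m q n|).+1 =>
  definable_ex_fin (fun I : {set 'I_m} =>
  definable_ex_fin (fun full : {set tp S p m q n} =>
    definable_sat_selection N f' I full)))).
exists g => G hG v w; rewrite -hg; split; last first.
  case=> m [N [I [full [a [b /hf' h]]]]].
  by rewrite tnth0 in h; eexists; exact: h.
case=> X [rX hX].
have [B cB hB] := cut_cover rX (hC G hG).
have hm : #|B| < bound.+1 by [].
pose a : #|B|.-tuple G := [tuple of enum B].
have eB : [set x in a] = B by apply/setP=> x; rewrite inE mem_enum.
have resX : respects a X.
  by apply: edge_closed_respects => x y; rewrite eB; apply: hB.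
have [N hN [b [I [full [hA resX' hX']]]]] := selection_equiv w q.+1 q v resX.
exists (Ordinal hm), (Ordinal (hN : N < _.+1)), I, full, a, b.
apply/(profile_sat (leqnn _) hA resX resX' hX').
by apply/hf'; rewrite tnth0.
Qed.

End SetElimination.

Theorem theorem1p1 (S : finType) (C : graph S -> Prop) (hC : weakly_sparse C)
    (n p : nat) (phi : lrmso S n p) :
  exists psi : sep S p n, equivalent_on C phi psi.
Proof.
elim: n p / phi.
- by move=> n p x y; exists (SEdge S p x y).
- by move=> n p x y; exists (SEq S p x y).
- by move=> n p c x; exists (SColor p c x).
- by move=> n p x X; exists (SMem S x X).
- move=> n p f [f' hf]; exists (SNot f') => G hG v w /=.
  by rewrite (hf G hG).
- move=> n p f [f' hf] g [g' hg]; exists (SAnd f' g') => G hG v w /=.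
  by rewrite (hf G hG) (hg G hG).
- move=> n p f [f' hf] g [g' hg]; exists (SOr f' g') => G hG v w /=.
  by rewrite (hf G hG) (hg G hG).
- move=> n p f [f' hf]; exists (SAll f') => G hG v w /=.
  by split=> h x; apply/(hf G hG).
- move=> n p f [f' hf]; exists (SEx f') => G hG v w /=.
  by split=> -[x h]; exists x; apply/(hf G hG).
- move=> n p r f [f' hf].
  have [g hg] := set_quantifier_elimination r (SNot f') hC.
  exists (SNot g) => G hG v w /=; rewrite -(hg G hG); split=> [h [X [rX]]|h X rX].
    by apply; apply/(hf G hG)/h.
  by apply: NNPP => hX; apply: h; exists X; split=> // /(hf G hG).
move=> n p r f [f' hf].
have [g hg] := set_quantifier_elimination r f' hC.
exists g => G hG v w /=; rewrite -(hg G hG).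
by split=> -[X [rX hX]]; exists X; split=> //; apply/(hf G hG).
Qed.
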